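(* Let $t\in\mathbb{R}$ and let $w$ be a weight on $\mathbb{R}$. (a) For $t>1/2$ and for $t\le 0$, the $t$-Haar multiplier $T^t_w$ is bounded on $L^2(\mathbb{R})$ if and only if the following $C_{2t}$ condition holds: $$[w]_{C_{2t}}:=\sup_{I\in\mathcal{D}}\langle w^{2t} \rangle_I\, \langle w\rangle^{-2t}_I<\infty.$$ Moreover, $\|T^t_w\|^2_{L^2(\mathbb{R})\to L^2(\mathbb{R})}\approx [w]_{C_{2t}}$. (b) For $0<t\le 1/2$, there is a constant $C_3>0$ such that $$\frac{1}{|I|} \sum_{J\in\mathcal{D}:\, J\subset I} |J|\, \frac{ |\Delta_J (w^{2t})|^2}{\langle w\rangle_J^{2t}} \leq C_3\, \langle w^{2t} \rangle_I \qquad \text{for all } I\in\mathcal{D}$$ if and only if $T^t_w$ is bounded on $L^2(\mathbb{R})$. Moreover, $\|T^t_w\|^2_{L^2(\mathbb{R})\to L^2(\mathbb{R})}\approx C_3$.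
   Context: A weight is an almost everywhere positive, locally integrable function on $\mathbb{R}$. $\mathcal{D}$ is the set of standard dyadic intervals $[2^{-j}k,2^{-j}(k+1))$, $j,k\in\mathbb{Z}$. For $I\in\mathcal{D}$, $I_+$ and $I_-$ are its right and left halves, $|I|$ is its length, $\mathbf{1}_I$ its characteristic function, $\langle f\rangle_I=\frac{1}{|I|}\int_I f(x)\,dx$, and $\Delta_I f=\langle f\rangle_{I_+}-\langle f\rangle_{I_-}$. The Haar function is $h_I=|I|^{-1/2}(\mathbf{1}_{I_+}-\mathbf{1}_{I_-})$, and $\langle f,g\rangle$ is the $L^2(\mathbb{R})$ inner product. The (unsigned) $t$-Haar multiplier is defined formally on locally integrable functions $f$ by $$T^t_{w} f(x) = \sum_{I\in \mathcal{D}} \left (\frac{w(x)}{\langle w\rangle_I}\right )^t \langle f,h_I\rangle \,h_I(x).$$ $A\lesssim B$ means that there is a constant $C>0$ such that $A\le CB$, and $A\approx B$ means $A\lesssim B$ and $B\lesssim A$.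
   Formalization: In (a), ‖T‖² ≲ [w]_{C_2t} is claimed with a constant depending on t and an upper bound for [w]_{C_2t} (a constant free of w is impossible for t≠0). In (b), C_3 is the best constant and the upper bound is ‖T‖² ≲ max(1, C_3), since w=1 gives best C_3=0 but ‖T‖=1. *)

(* Defs.v *)
From mathcomp Require Import all_boot all_order all_algebra finmap.
From mathcomp Require Import all_classical all_reals all_analysis.
Set Implicit Arguments.
Unset Strict Implicit.
Unset Printing Implicit Defensive.
Import Order.TTheory GRing.Theory Num.Theory.
Import numFieldNormedType.Exports.
Local Open Scope classical_set_scope.
Local Open Scope ring_scope.

Section haar_multiplier.
Context {R : realType}.
Local Notation mu := (@lebesgue_measure R).

Definition weight (w : R -> R) : Prop :=
  locally_integrable [set: R] w /\ {ae mu, forall x, 0 < w x}.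

(* The pair (j, k) stands for [2^-j k, 2^-j (k + 1)[; distinct pairs give
   distinct intervals, so indexing by pairs does not repeat any interval. *)
Definition dyadic := (int * int)%type.

Definition dlen (I : dyadic) : R := 2 ^ (- I.1).

Definition ditv (I : dyadic) : set R :=
  `[dlen I * I.2%:~R, dlen I * (I.2 + 1)%:~R[.

Definition dleft (I : dyadic) : dyadic := (I.1 + 1, 2 * I.2).
Definition dright (I : dyadic) : dyadic := (I.1 + 1, 2 * I.2 + 1).

(* Extended average, possibly +oo, used for w ^ (2 t) when it is not known to
   be locally integrable. *)
Definition avge (f : R -> R) (I : dyadic) : \bar R :=
  ((dlen I)^-1%:E * \int[mu]_(x in ditv I) (f x)%:E)%E.

Definition avg (f : R -> R) (I : dyadic) : R :=
  (dlen I)^-1 * \int[mu]_(x in ditv I) f x.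

Definition avg_jump (f : R -> R) (I : dyadic) : R :=
  avg f (dright I) - avg f (dleft I).

Definition haar (I : dyadic) (x : R) : R :=
  (Num.sqrt (dlen I))^-1 * (\1_(ditv (dright I)) x - \1_(ditv (dleft I)) x).

Definition haar_coef (f : R -> R) (I : dyadic) : R :=
  \int[mu]_x (f x * haar I x).

Definition haar_mult_sum (w : R -> R) (t : R) (F : {fset dyadic})
    (f : R -> R) (x : R) : R :=
  \sum_(I <- F) (w x / avg w I) `^ t * haar_coef f I * haar I x.

Definition norm2 (f : R -> R) : \bar R := 'N[mu]_2%:E [EFin \o f]%E.

(* g is the sum of the series T^t_w f: the partial sums over finite families
   of dyadic intervals converge unconditionally to g in L^2. *)
Definition is_haar_mult (w : R -> R) (t : R) (f g : R -> R) : Prop :=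
  g \in Lfun mu 2%:E /\
  forall eps : R, 0 < eps -> exists F0 : {fset dyadic},
    forall F : {fset dyadic}, (F0 `<=` F)%fset ->
      (norm2 (g \- haar_mult_sum w t F f)%R <= eps%:E)%E.

Definition haar_mult_bound (w : R -> R) (t K : R) : Prop :=
  0 <= K /\
  forall f : R -> R, f \in Lfun mu 2%:E ->
    exists2 g : R -> R, is_haar_mult w t f g &
      (norm2 g <= K%:E * norm2 f)%E.

Definition haar_mult_bounded (w : R -> R) (t : R) : Prop :=
  exists K : R, haar_mult_bound w t K.

(* Equal to +oo when T^t_w is not bounded. *)
Definition haar_mult_norm (w : R -> R) (t : R) : \bar R :=
  ereal_inf [set K%:E | K in [set K : R | haar_mult_bound w t K]].

Definition C_char (w : R -> R) (s : R) : \bar R :=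
  ereal_sup
    [set (avge (fun x => w x `^ s)%R I * (avg w I `^ (- s))%:E)%E
      | I in [set: dyadic]].

Definition carleson (w : R -> R) (t C3 : R) : Prop :=
  forall I : dyadic,
    ((dlen I)^-1%:E * (\esum_(J in [set J : dyadic | ditv J `<=` ditv I])
       (dlen J * (`|avg_jump (fun x => w x `^ (2 * t))%R J| ^+ 2
                    / avg w J `^ (2 * t)))%:E)
     <= C3%:E * avge (fun x => w x `^ (2 * t))%R I)%E.

(* The infimum of the admissible constants; +oo when there are none. *)
Definition carleson_const (w : R -> R) (t : R) : \bar R :=
  ereal_inf [set C3%:E | C3 in [set C3 : R | 0 < C3 /\ carleson w t C3]].

End haar_multiplier.

(* Main.v *)
Require Import Defs.
From mathcomp Require Import all_boot all_order all_algebra finmap.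
From mathcomp Require Import all_classical all_reals all_analysis.
From mathcomp Require Import measurable_realfun.
From mathcomp Require Import ring lra zify.
Set Implicit Arguments.
Unset Strict Implicit.
Unset Printing Implicit Defensive.
Import Order.TTheory GRing.Theory Num.Theory.
Import numFieldNormedType.Exports.
Local Open Scope classical_set_scope.
Local Open Scope ring_scope.

(** Write m_J for the mean of w over J, sigma = w^(2t) = v^2 with v = w^t, and
phi_J = (w / m_J)^t h_J, so that the multiplier T is f |-> sum_J <f, h_J> phi_J.

The Haar functions being orthonormal, T is bounded with norm at most K exactly
when the phi_J form a Bessel system: sum_J <f, phi_J>^2 <= K^2 |f|^2 for all f
in L^2. One direction is duality followed by a Riesz-Fischer argument
([haar_mult_bound_of_bessel]), the other tests T on finite Haar sums
([bessel_of_haar_mult_bound]).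

With f(J) the integral of f v over J and sigma(J) that of sigma,
  <f, phi_J> = m_J^(-t) |J|^(-1/2) (f(J+) - f(J-)),
and f(J+) - f(J-) splits into a jump of the means f(J) / sigma(J) and a jump of
sigma weighted by such a mean. The squares of the first kind are summable since
f(J)^2 / sigma(J) is convex in the pair, provided that the mean of sigma over J
is at most C m_J^(2t); those of the second kind are summable by Carleson
embedding, provided that the numbers |J| |Delta_J sigma|^2 / m_J^(2t) satisfy a
Carleson packing condition with respect to sigma ([tree_square_function]). So
these two conditions together bound T ([haar_mult_bound_of_carleson]). Both are
necessary: the norm of phi_J gives the first one
([avg_of_haar_mult_bound]), and the Bessel inequality for f = v on I, 0 outside,
gives the second one ([jump_energy_of_haar_mult_bound]).

If 0 < 2t <= 1, the first condition holds with C = 1 since x^(2t) is concave,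
and only the packing condition remains. If s = 2t satisfies s > 1 or s <= 0, the
first condition is C_2t and it implies the second one: Phi (x, y) = x^(2s) / y is
convex on the whole quadrant x, y > 0, Phi <= y on the means (x, y) of w and
sigma since x^s <= y there, and the convexity defect of Phi between the two
halves of J dominates the squared jump of y ([bellman_step], [bellman_tree]). The
convexity of Phi on a convex domain is what makes dyadic splittings harmless,
although the region x^s <= y <= M x^s is not convex.

All the statements only depend on w up to a null set, and w can be taken
positive everywhere ([positive_version]), which makes real powers of w
multiplicative. *)

(** * Convexity of real powers and the Bellman function *)

Section power_inequalities.
Context {R : realType}.
Implicit Types (s x y a M C : R).

Lemma powRE s x : 0 < x -> x `^ s = expR (s * ln x).
Proof. by move=> x0; rewrite /powR gt_eqF. Qed.

Lemma expR_weighted_mean a b (th : R) : 0 <= th <= 1 ->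
  expR (th * a + (1 - th) * b) <= th * expR a + (1 - th) * expR b.
Proof.
move=> /andP[th0 th1].
by have := convex_expR (Itv01 th0 th1) a b; rewrite !convRE.
Qed.

(** Convexity of the exponential in [ln x], between [ln x] and 0. *)
Lemma bernoulli_le s x : 0 <= s <= 1 -> 0 < x -> x `^ s <= 1 + s * (x - 1).
Proof.
move=> s01 x0; rewrite powRE//.
have := expR_weighted_mean (ln x) 0 s01.
by rewrite expR0 lnK ?posrE// mulr0 addr0 => /le_trans; apply; lra.
Qed.

(** The exponents s and 1, or s and 0, are swapped with respect to
[bernoulli_le]: for s >= 1, x is a weighted geometric mean of x^s and 1, and for
s <= 0, 1 is one of x^s and x. *)
Lemma bernoulli_ge s x : 1 <= s \/ s <= 0 -> 0 < x ->
  1 + s * (x - 1) <= x `^ s.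
Proof.
move=> hs x0; rewrite powRE//; case: hs => hs.
  have s0 : 0 < s by lra.
  have sV : 0 <= s^-1 <= 1 by rewrite invr_ge0 ltW//= invf_le1.
  have := expR_weighted_mean (s * ln x) 0 sV.
  rewrite mulr0 addr0 mulKf ?gt_eqF// lnK ?posrE// expR0.
  set E := expR _ => h.
  have : s * x <= s * (s^-1 * E + (1 - s^-1) * 1) by rewrite ler_pM2l.
  have -> : s * (s^-1 * E + (1 - s^-1) * 1) = E + s - 1.
    by field; rewrite gt_eqF.
  lra.
have s1 : 0 < 1 - s by lra.
have sV : 0 <= (1 - s)^-1 <= 1.
  by rewrite invr_ge0 ltW//= invf_le1//; lra.
have := expR_weighted_mean (s * ln x) (ln x) sV.
have -> : (1 - s)^-1 * (s * ln x) + (1 - (1 - s)^-1) * ln x = 0.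
  by field; rewrite gt_eqF.
rewrite expR0 lnK ?posrE//; set E := expR _ => h.
have : (1 - s) * 1 <= (1 - s) * ((1 - s)^-1 * E + (1 - (1 - s)^-1) * x).
  by rewrite ler_pM2l.
have -> : (1 - s) * ((1 - s)^-1 * E + (1 - (1 - s)^-1) * x) = E - s * x.
  by field; rewrite gt_eqF.
lra.
Qed.

(** For s >= 2, x^s is a power at least 1 of x^2. For 1 < s < 2, x^s is x^2
divided by x^(2 - s), to which [bernoulli_le] applies; the quadratic term then
comes from 1 - s (2 - s) = (s - 1)^2. *)
Lemma bernoulli_strict s : 1 < s -> exists2 c : R, 0 < c &
  forall x, 0 < x <= 2 -> 1 + s * (x - 1) + c * (x - 1) ^+ 2 <= x `^ s.
Proof.
move=> s1; case: (lerP 2 s) => s2.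
  exists (s / 2); first lra.
  move=> x /andP[x0 _].
  have -> : x `^ s = (x ^+ 2) `^ (s / 2).
    by rewrite -powR_mulrn ?ltW// -powRrM; congr powR; field.
  apply: le_trans (bernoulli_ge _ _); last by rewrite exprn_gt0.
    by lra.
  by left; lra.
exists ((s - 1) ^+ 2 / 2).
  by rewrite divr_gt0// exprn_gt0//; lra.
move=> x /andP[x0 x2].
set q := 2 - s.
have q01 : 0 <= q <= 1 by rewrite /q; lra.
have B := bernoulli_le q01 x0.
have D0 : 0 < 1 + q * (x - 1) by apply: lt_le_trans B; exact: powR_gt0.
have D2 : 1 + q * (x - 1) <= 2 by rewrite /q; nra.
have -> : x `^ s = x ^+ 2 / x `^ q.
  rewrite -powR_mulrn ?ltW// -powRB; last by rewrite (gt_eqF x0) implybT.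
  by congr powR; rewrite /q; ring.
apply: (@le_trans _ _ (x ^+ 2 / (1 + q * (x - 1)))); last first.
  by rewrite ler_pM2l ?exprn_gt0// lef_pV2 ?posrE// powR_gt0.
rewrite ler_pdivlMr//.
have : 0 <= (s - 1) ^+ 2 / 2 * (x - 1) ^+ 2 * (2 - (1 + q * (x - 1))).
  by rewrite mulr_ge0 ?subr_ge0// mulr_ge0 ?sqr_ge0// divr_ge0// sqr_ge0.
by rewrite /q; nra.
Qed.

(** Quantitative midpoint convexity of x^s. Comparing squares makes the condition
homogeneous in (x1, x2), with a constant that depends on s only. *)
Definition convexity_gap s C := forall x1 x2 : R, 0 < x1 -> 0 < x2 ->
  let u1 := x1 `^ s in let u2 := x2 `^ s in let u := ((x1 + x2) / 2) `^ s in
  u <= (u1 + u2) / 2 /\ ((u1 - u2) / 2) ^+ 2 <= C * (((u1 + u2) / 2) ^+ 2 - u ^+ 2).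

Lemma midpoint_powR s x1 x2 : 1 <= s \/ s <= 0 -> 0 < x1 -> 0 < x2 ->
  ((x1 + x2) / 2) `^ s <= (x1 `^ s + x2 `^ s) / 2.
Proof.
move=> hs x10 x20; set x := (x1 + x2) / 2.
have x0 : 0 < x by rewrite /x; lra.
have tangent z : 0 < z -> x `^ s * (1 + s * (z / x - 1)) <= z `^ s.
  move=> z0; have -> : z `^ s = x `^ s * (z / x) `^ s.
    by rewrite -(powRM _ (ltW x0) (divr_ge0 (ltW z0) (ltW x0))) mulrC divfK// gt_eqF.
  by rewrite (ler_pM2l (powR_gt0 _ x0)); apply: bernoulli_ge => //; exact: divr_gt0.
have := tangent _ x10; have := tangent _ x20.
have E : x `^ s * (1 + s * (x2 / x - 1)) + x `^ s * (1 + s * (x1 / x - 1)) =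
   2 * x `^ s.
  have -> : x2 = 2 * x - x1 by rewrite /x; field.
  by field; rewrite gt_eqF.
lra.
Qed.

(** The difference of the squared mean and of the squared half difference is the
product x1^s x2^s, and x1 x2 is at most the square of the midpoint. *)
Lemma convexity_gap_le0 s : s <= 0 -> convexity_gap s 1.
Proof.
move=> s0 x1 x2 x10 x20 /=; split; first by apply: midpoint_powR => //; right.
set x := (x1 + x2) / 2.
have x0 : 0 < x by rewrite /x; lra.
suff : x `^ s ^+ 2 <= x1 `^ s * x2 `^ s.
  by rewrite !expr2; set u1 := x1 `^ s; set u2 := x2 `^ s; lra.
have x12 : 0 < x1 * x2 by exact: mulr_gt0.
have xx : 0 < x * x by exact: mulr_gt0.
rewrite expr2 -(powRM _ (ltW x0) (ltW x0)) -(powRM _ (ltW x10) (ltW x20)).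
rewrite -[s]opprK 2!(powRN _ (- s)).
rewrite lef_pV2; try by rewrite posrE powR_gt0.
apply: ge0_ler_powR; rewrite ?nnegrE ?(ltW x12) ?(ltW xx) ?oppr_ge0//.
rewrite /x; have := sqr_ge0 (x1 - x2); rewrite !expr2; lra.
Qed.

(** By homogeneity the points are 1 + a and 1 - a with 0 <= a < 1: the gap is at
least of order a^2 by [bernoulli_strict], and the oscillation at most of order a
since x^s is Lipschitz on [0, 2]. *)
Lemma convexity_gap_gt1 s : 1 < s -> exists2 C, 0 <= C & convexity_gap s C.
Proof.
move=> s1; have [c c0 Hc] := bernoulli_strict s1.
pose L := (s * 2 `^ s) ^+ 2.
have L0 : 0 <= L by exact: sqr_ge0.
exists (L / (2 * c)); first by rewrite divr_ge0// mulr_ge0// ltW.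
move=> x1 x2; wlog x12 : x1 x2 / x2 <= x1.
  move=> W x10 x20; case/orP: (le_total x2 x1) => h; first exact: W.
  have /= := W _ _ h x20 x10; rewrite (addrC x2 x1) (addrC (x2 `^ s)).
  by rewrite -(opprB (x1 `^ s)) mulNr sqrrN.
move=> x10 x20 /=; split; first by apply: midpoint_powR => //; left; lra.
set x := (x1 + x2) / 2; pose a := (x1 - x2) / (x1 + x2).
have x0 : 0 < x by rewrite /x; lra.
have x12n : x1 + x2 != 0 by rewrite gt_eqF//; lra.
have e1 : x1 = x * (1 + a) by rewrite /x /a; field.
have e2 : x2 = x * (1 - a) by rewrite /x /a; field.
have a0 : 0 <= a by rewrite /a divr_ge0//; lra.
have a1 : a < 1 by rewrite /a ltr_pdivrMr ?mul1r; lra.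
have pa : 0 < 1 + a by lra.
have na : 0 < 1 - a by lra.
rewrite e1 e2 (powRM _ (ltW x0) (ltW pa)) (powRM _ (ltW x0) (ltW na)).
set X := x `^ s; have X0 : 0 < X by exact: powR_gt0.
set p := (1 + a) `^ s; set n := (1 - a) `^ s.
have p0 : 0 <= p by exact: powR_ge0.
have Hp : 1 + s * a + c * a ^+ 2 <= p.
  have := Hc (1 + a); have -> : 1 + a - 1 = a by ring.
  by apply; lra.
have Hn : 1 - s * a + c * a ^+ 2 <= n.
  have := Hc (1 - a); have -> : 1 - a - 1 = - a by ring.
  by rewrite mulrN sqrrN; apply; lra.
(* Bernoulli at (1 - a) / (1 + a) bounds the difference quotient of x^s. *)
have Hd : p - n <= 2 * a * (s * 2 `^ s).
  have h : p * (1 + s * ((1 - a) / (1 + a) - 1)) <= n.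
    have -> : n = p * ((1 - a) / (1 + a)) `^ s.
      by rewrite -(powRM _ (ltW pa) (divr_ge0 (ltW na) (ltW pa))) mulrC divfK// gt_eqF.
    rewrite ler_pM2l ?powR_gt0//.
    by apply: bernoulli_ge; [left; lra|exact: divr_gt0].
  have e : p * (1 + s * ((1 - a) / (1 + a) - 1)) = p - 2 * a * s * (p / (1 + a)).
    by field; rewrite gt_eqF.
  have pl : p / (1 + a) <= 2 `^ s.
    apply: (@le_trans _ _ p).
      by rewrite ler_pdivrMr//; nra.
    by apply: ge0_ler_powR; rewrite ?nnegrE; lra.
  have : 2 * a * s * (p / (1 + a)) <= 2 * a * s * 2 `^ s.
    by apply: ler_wpM2l => //; nra.
  lra.
have np : n <= p by apply: ge0_ler_powR; rewrite ?nnegrE; lra.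
have Hd2 : ((p - n) / 2) ^+ 2 <= L * a ^+ 2.
  have -> : L * a ^+ 2 = (a * (s * 2 `^ s)) ^+ 2 by rewrite /L; ring.
  by rewrite ler_sqr ?nnegrE; [lra|lra|nra].
have Hm : 2 * (c * a ^+ 2) <= ((p + n) / 2) ^+ 2 - 1.
  have a20 : 0 <= c * a ^+ 2 by rewrite mulr_ge0 ?sqr_ge0// ltW.
  have h1 : 1 + c * a ^+ 2 <= (p + n) / 2 by lra.
  have : (1 + c * a ^+ 2) ^+ 2 <= ((p + n) / 2) ^+ 2.
    by rewrite ler_sqr ?nnegrE; lra.
  have := sqr_ge0 (c * a ^+ 2).
  lra.
have -> : ((X * p - X * n) / 2) ^+ 2 = X ^+ 2 * ((p - n) / 2) ^+ 2 by ring.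
have -> : L / (2 * c) * (((X * p + X * n) / 2) ^+ 2 - X ^+ 2) =
  X ^+ 2 * (L * ((((p + n) / 2) ^+ 2 - 1) / (2 * c))).
  by field; rewrite gt_eqF.
rewrite (ler_pM2l (exprn_gt0 2 X0)); apply: le_trans Hd2 _.
apply: ler_wpM2l => //; rewrite ler_pdivlMr ?mulr_gt0//; lra.
Qed.

Lemma convexity_gap_exists s : 1 < s \/ s <= 0 ->
  exists2 C, 0 <= C & convexity_gap s C.
Proof.
by case=> hs; [exact: convexity_gap_gt1|exists 1 => //; exact: convexity_gap_le0].
Qed.

(** With u the values of x^s, v their mean and d, e the half jumps of u and y, the
convexity defect of u^2 / y is the sum of (d y - v e)^2 / (y1 y2 y) and of
(v^2 - u^2) / y. The first term makes e comparable to d, and the second one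
controls d by the convexity gap of x^s. *)
Lemma bellman_step s C M : 0 <= C -> convexity_gap s C ->
  forall x1 x2 y1 y2 : R, 0 < x1 -> 0 < x2 -> 0 < y1 -> 0 < y2 ->
  let x := (x1 + x2) / 2 in let y := (y1 + y2) / 2 in
  y <= M * x `^ s ->
  (y1 - y2) ^+ 2 / x `^ s <= 8 * (1 + C) * M ^+ 3 *
    (((x1 `^ s) ^+ 2 / y1 + (x2 `^ s) ^+ 2 / y2) / 2 - (x `^ s) ^+ 2 / y).
Proof.
move=> C0 HC x1 x2 y1 y2 x10 x20 y10 y20 x y yM.
have x0 : 0 < x by rewrite /x; lra.
have y0 : 0 < y by rewrite /y; lra.
have [Hm Hd] := HC _ _ x10 x20; rewrite -/x in Hm Hd.
set u1 := x1 `^ s in Hm Hd *; set u2 := x2 `^ s in Hm Hd *.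
have u0 : 0 < x `^ s by exact: powR_gt0.
set u := x `^ s in Hm Hd u0 yM *.
pose v := (u1 + u2) / 2; pose d := (u1 - u2) / 2; pose e := (y1 - y2) / 2.
rewrite -/v -/d in Hm Hd.
set G := (_ / 2 - _).
pose G1 := (d * y - v * e) ^+ 2 / (y1 * y2 * y).
pose G2 := (v ^+ 2 - u ^+ 2) / y.
have GE : G = G1 + G2.
  rewrite /G /G1 /G2 /v /d /e /y.
  by field; rewrite !gt_eqF//; lra.
have y12 : y1 * y2 <= y ^+ 2 by rewrite /y; have := sqr_ge0 (y1 - y2); lra.
have H1 : (d * y - v * e) ^+ 2 <= y ^+ 3 * G1.
  have yyy : 0 < y1 * y2 * y := mulr_gt0 (mulr_gt0 y10 y20) y0.
  have -> : y ^+ 3 * G1 = (d * y - v * e) ^+ 2 * (y ^+ 3 / (y1 * y2 * y)).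
    exact: mulrCA.
  apply: ler_peMr; first exact: sqr_ge0.
  by rewrite (ler_pdivlMr _ _ yyy) mul1r exprSr ler_pM2r.
have H2 : v ^+ 2 - u ^+ 2 = y * G2 by rewrite /G2; field; rewrite gt_eqF.
have uv : u ^+ 2 <= v ^+ 2 by rewrite ler_sqr ?nnegrE; lra.
have G10 : 0 <= G1 by exact: divr_ge0 (sqr_ge0 _) (ltW (mulr_gt0 (mulr_gt0 y10 y20) y0)).
have G20 : 0 <= G2.
  by apply: divr_ge0 (ltW y0); rewrite subr_ge0.
have H3 : u ^+ 2 * e ^+ 2 <= 2 * (1 + C) * y ^+ 3 * G.
  apply: (@le_trans _ _ (2 * (d * y - v * e) ^+ 2 + 2 * (d * y) ^+ 2)).
    apply: (@le_trans _ _ ((v * e) ^+ 2)).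
      by rewrite (exprMn _ v e) ler_wpM2r// sqr_ge0.
    by have := sqr_ge0 ((d * y - v * e) + (d * y)); lra.
  have Hdy : (d * y) ^+ 2 <= C * (y ^+ 3 * G2).
    have -> : C * (y ^+ 3 * G2) = C * (v ^+ 2 - u ^+ 2) * y ^+ 2.
      by rewrite H2; ring.
    by rewrite (exprMn _ d y) ler_wpM2r// sqr_ge0.
  have : 0 <= C * (y ^+ 3 * G1).
    exact: mulr_ge0 C0 (mulr_ge0 (exprn_ge0 3 (ltW y0)) G10).
  have : 0 <= y ^+ 3 * G2 := mulr_ge0 (exprn_ge0 3 (ltW y0)) G20.
  by rewrite GE; lra.
have G0 : 0 <= G by rewrite GE addr_ge0.
have H4 : u ^+ 2 * e ^+ 2 <= 2 * (1 + C) * (M * u) ^+ 3 * G.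
  apply: le_trans H3 _; rewrite ler_wpM2r// ler_wpM2l//; first by lra.
  by rewrite lerXn2r ?nnegrE ?(ltW y0)// (le_trans _ yM)// ltW.
rewrite ler_pdivrMr// -(@ler_pM2r _ (u ^+ 2)) ?exprn_gt0//.
have -> : (y1 - y2) ^+ 2 = 4 * e ^+ 2 by rewrite /e; field.
lra.
Qed.

End power_inequalities.

(** * Dyadic intervals and their descendants *)

Fixpoint descendants n (I : dyadic) : seq dyadic :=
  if n is m.+1 then I :: descendants m (dleft I) ++ descendants m (dright I)
  else [::].

Section dyadic_combinatorics.
Implicit Types (I J P : dyadic) (n m : nat).

Lemma descendants_self n I : I \in descendants n.+1 I.
Proof. by rewrite /= inE eqxx. Qed.

Lemma descendantsW n m I J : (n <= m)%N ->
  J \in descendants n I -> J \in descendants m I.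
Proof.
elim: n m I => [//|n IH] [//|m] I /=; rewrite ltnS => nm.
rewrite !inE !mem_cat => /or3P[->//|/(IH _ _ nm)->|/(IH _ _ nm)->];
by rewrite ?orbT.
Qed.

Lemma descendants_half n I P J : P = dleft I \/ P = dright I ->
  J \in descendants n P -> J \in descendants n.+1 I.
Proof. by case=> -> h; rewrite /= inE mem_cat h ?orbT. Qed.

Lemma half_descendants n I P J : J = dleft P \/ J = dright P ->
  P \in descendants n I -> J \in descendants n.+1 I.
Proof.
move=> hJ; elim: n I => [//|n IH] I; rewrite [in X in X -> _]/= inE mem_cat.
case/or3P => [/eqP hP|h|h].
- rewrite hP in hJ; apply: (descendants_half (P := J)) => //.
  exact: descendants_self.
- by apply: descendants_half (IH _ h); left.
- by apply: descendants_half (IH _ h); right.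
Qed.

Lemma descendants_gen n I J : J \in descendants n I -> I.1 <= J.1.
Proof.
elim: n I => [//|n IH] I; rewrite /= inE mem_cat.
case/or3P => [/eqP->//|/IH/=|/IH/=]; exact: le_trans (ler_wpDr _ _).
Qed.

Lemma parent_exists J : exists2 P, P.1 = J.1 - 1 & J = dleft P \/ J = dright P.
Proof.
exists (J.1 - 1, (J.2 %/ 2)%Z) => //.
have e := divz_eq J.2 2; have h : 0 <= (J.2 %% 2)%Z < 2.
  by rewrite modz_ge0//= ltz_pmod.
have [h0|h1] : (J.2 %% 2)%Z = 0 \/ (J.2 %% 2)%Z = 1.
  move: h; case: (_ %% _)%Z => // -[|[|//]] _; by [left|right].
- by left; rewrite /dleft/= subrK {1}(surjective_pairing J) {1}e h0 addr0 mulrC.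
- by right; rewrite /dright/= subrK {1}(surjective_pairing J) {1}e h1 mulrC.
Qed.

Lemma ancestor_exists n J : exists2 A, A.1 = J.1 - n%:Z & J \in descendants n.+1 A.
Proof.
elim: n => [|n [A eA hA]].
  by exists J; rewrite ?subr0// descendants_self.
have [P eP hP] := parent_exists A; exists P; first by rewrite eP eA; lra.
exact: descendants_half hP hA.
Qed.

Lemma parent_index_lt P J : J = dleft P \/ J = dright P ->
  J.2 != 0 -> J.2 != -1 -> (absz P.2 < absz J.2)%N.
Proof. by case: P => p k [->|->] /=; lia. Qed.

Lemma descends_from_origin J : exists i n,
  J \in descendants n (i, 0) \/ J \in descendants n (i, -1).
Proof.
have [m] := ubnP (absz J.2); elim: m J => // m IH J Jm.
have [J0|J0] := eqVneq J.2 0.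
  by exists J.1, 1%N; left; rewrite inE {1}(surjective_pairing J) J0.
have [J1|J1] := eqVneq J.2 (-1).
  by exists J.1, 1%N; right; rewrite inE {1}(surjective_pairing J) J1.
have [P _ hP] := parent_exists J.
have Pm : (absz P.2 < m)%N by apply: leq_trans (parent_index_lt hP J0 J1) _.
have [i [n [h|h]]] := IH P Pm; exists i, n.+1.
  by left; apply: half_descendants h.
by right; apply: half_descendants h.
Qed.

Lemma origin_descendants_down (e : int) n k i J : e = 0 \/ e = -1 ->
  J \in descendants n (i, e) -> J \in descendants (n + k) (i - k%:Z, e).
Proof.
move=> he h; elim: k => [|k IH]; first by rewrite addn0 subr0.
rewrite addnS; apply: descendants_half IH.
case: he => ->; [left|right].
- by rewrite /dleft/= mulr0; congr pair; lra.
- by rewrite /dright/=; congr pair; lra.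
Qed.

(** Only two dyadic intervals of each length touch the origin; large enough
ones lie above any given finite family. *)
Lemma finite_family_below (s : seq dyadic) : exists i n, {subset s <=
  descendants n (i, 0) ++ descendants n (i, -1)}.
Proof.
elim: s => [|J s [i1 [n1 h1]]]; first by exists 0, 0%N.
have [i2 [n2 h2]] := descends_from_origin J.
pose i := Num.min i1 i2.
have e1 : i = i1 - (absz (i1 - i))%:Z by rewrite /i; case: (leP i1 i2); lia.
have e2 : i = i2 - (absz (i2 - i))%:Z by rewrite /i; case: (leP i1 i2); lia.
set k1 := absz _ in e1; set k2 := absz _ in e2.
pose n := maxn (n1 + k1) (n2 + k2).
have l1 : (n1 + k1 <= n)%N by exact: leq_maxl.
have l2 : (n2 + k2 <= n)%N by exact: leq_maxr.
have D1 e K : e = 0 \/ e = -1 -> K \in descendants n1 (i1, e) ->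
    K \in descendants n (i, e).
  by move=> he h; apply: (descendantsW l1); rewrite e1; apply: origin_descendants_down.
have D2 e K : e = 0 \/ e = -1 -> K \in descendants n2 (i2, e) ->
    K \in descendants n (i, e).
  by move=> he h; apply: (descendantsW l2); rewrite e2; apply: origin_descendants_down.
exists i, n => K; rewrite inE mem_cat => /predU1P[->|/h1].
  by case: h2 => /D2->; rewrite ?orbT; auto.
by rewrite mem_cat => /orP[] /D1->; rewrite ?orbT; auto.
Qed.

Lemma dleft_neq_dright I : dleft I != dright I.
Proof. by rewrite /dleft /dright xpair_eqE eqxx/=; lia. Qed.

End dyadic_combinatorics.

Section dyadic_intervals.
Context {R : realType}.
Implicit Types (I J P : dyadic) (x : R) (n : nat).

Lemma dlen_gt0 I : 0 < dlen I :> R.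
Proof. exact: exprz_gt0. Qed.

Lemma dlen_same_gen I J : I.1 = J.1 -> dlen I = dlen J :> R.
Proof. by rewrite /dlen => ->. Qed.

Lemma dlen_dleft I : dlen (dleft I) = dlen I / 2 :> R.
Proof. by rewrite /dlen /= opprD expfzDr ?pnatr_eq0// -invr_expz expr1z. Qed.

Lemma dlen_dright I : dlen (dright I) = dlen I / 2 :> R.
Proof. by rewrite -dlen_dleft. Qed.

Lemma in_ditv I x : ditv I x = (I.2 == Num.floor (x / dlen I)).
Proof.
have d0 := dlen_gt0 I.
rewrite /ditv/= in_itv/=; apply/propext; split.
- move=> /andP[h1 h2]; apply/eqP; apply/esym/Num.Theory.floor_def.
  by rewrite ler_pdivlMr// ltr_pdivrMr// ![_ * dlen I]mulrC h1.
- move=> /eqP->; have := Num.Theory.floor_itv (x / dlen I).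
  by rewrite ler_pdivlMr// ltr_pdivrMr// ![_ * dlen I]mulrC.
Qed.

(** The indicator function as a real function: inclusions and disjointness of
dyadic intervals become pointwise identities between products. *)
Definition dind I x : R := \1_(ditv I) x.

Lemma dindE I x : dind I x = (I.2 == Num.floor (x / dlen I))%:R.
Proof.
rewrite /dind indicE; congr ((nat_of_bool _)%:R); apply/idP/idP.
  by move/set_mem; rewrite in_ditv.
by move=> h; apply/mem_set; rewrite in_ditv.
Qed.

Lemma dind_same_gen I J x : I.1 = J.1 -> I != J -> dind I x * dind J x = 0.
Proof.
move=> g; rewrite !dindE -(dlen_same_gen g) -natrM mulnb => IJ.
case: eqP => //= h1; case: eqP => //= h2; case/eqP: IJ.
by rewrite (surjective_pairing I) (surjective_pairing J) g h1 h2.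
Qed.

Lemma dind_halves I x : dind I x = dind (dleft I) x + dind (dright I) x.
Proof.
rewrite !dindE dlen_dleft dlen_dright /=.
have d0 := dlen_gt0 I; set y := x / dlen I.
have -> : x / (dlen I / 2) = 2 * y by rewrite /y; field; rewrite gt_eqF.
have /andP[h1 h2] := Num.Theory.floor_itv y.
have /andP[k1 k2] := Num.Theory.floor_itv (2 * y).
have l1 : 2 * Num.floor y < Num.floor (2 * y) + 1.
  by rewrite -(@ltr_int R) rmorphM/=; apply: le_lt_trans k2; lra.
have l2 : Num.floor (2 * y) < 2 * (Num.floor y + 1).
  by rewrite -(@ltr_int R) rmorphM/=; apply: le_lt_trans k1 _; lra.
rewrite -natrD; congr (_%:R); lia.
Qed.

Lemma dind_dleft_dright I x : dind (dleft I) x * dind (dright I) x = 0.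
Proof. by rewrite dind_same_gen// dleft_neq_dright. Qed.

Lemma dind_sqr I x : dind I x ^+ 2 = dind I x.
Proof. by rewrite dindE; case: (_ == _); rewrite ?expr1n// expr0n. Qed.

Lemma dind_ge0 I x : 0 <= dind I x.
Proof. by rewrite dindE ler0n. Qed.

Lemma dind_half I P x : P = dleft I \/ P = dright I ->
  dind P x * dind I x = dind P x.
Proof.
have e := dind_dleft_dright I x.
case=> ->; rewrite (dind_halves I) mulrDr -expr2 dind_sqr.
  by rewrite e addr0.
by rewrite (mulrC (dind (dright I) x)) e add0r.
Qed.

Lemma dind_descendants n I J x : J \in descendants n I ->
  dind J x * dind I x = dind J x.
Proof.
elim: n I => [//|n IH] I; rewrite /= inE mem_cat.
case/or3P => [/eqP->|/IH h|/IH h]; first by rewrite -expr2 dind_sqr.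
  by rewrite -h -mulrA (@dind_half I)//; left.
by rewrite -h -mulrA (@dind_half I)//; right.
Qed.

Lemma measurable_ditv I : measurable (ditv I : set R).
Proof. exact: measurable_itv. Qed.

Lemma mu_ditv I : lebesgue_measure (ditv I : set R) = (dlen I)%:E.
Proof.
rewrite lebesgue_measure_itv/= lte_fin ltr_pM2l ?dlen_gt0// ltr_int ltrDl ltr01.
by rewrite -EFinD -mulrBr rmorphD/= addrC addKr mulr1.
Qed.

Lemma dind_eq1 I x : ditv I x -> dind I x = 1.
Proof. by move=> h; rewrite /dind indicE mem_set. Qed.

Lemma dind_eq0 I x : ~ ditv I x -> dind I x = 0.
Proof. by move=> h; rewrite /dind indicE memNset. Qed.

Lemma ditv_nonempty I : exists x, ditv I x.
Proof.
exists (dlen I * I.2%:~R); rewrite /ditv/= in_itv/= lexx/=.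
by rewrite ltr_pM2l ?dlen_gt0// ltr_int ltrDl.
Qed.

Lemma subset_ditvP I J : (ditv J `<=` (ditv I : set R)) <->
  forall x, dind J x * dind I x = dind J x.
Proof.
split=> h x.
  have [Jx|Jx] := pselect (ditv J x); last by rewrite dind_eq0 ?mul0r.
  by rewrite !dind_eq1 ?mulr1//; exact: h.
move=> Jx; apply: contrapT => nIx; have := h x.
rewrite (dind_eq1 Jx) (dind_eq0 nIx) mulr0 => /esym/eqP.
by rewrite oner_eq0.
Qed.

(** The ancestor of J in the generation of I is either I or disjoint from I. *)
Lemma dyadic_dichotomy I J : I.1 <= J.1 ->
  (exists n, J \in descendants n I) \/ forall x, dind J x * dind I x = 0.
Proof.
move=> IJ; have [A eA hA] := ancestor_exists (absz (J.1 - I.1)) J.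
have gA : A.1 = I.1 by rewrite eA; lia.
have [AI|AI] := eqVneq A I; first by left; exists (absz (J.1 - I.1)).+1; rewrite -{2}AI.
right=> x; rewrite -(dind_descendants x hA) -mulrA dind_same_gen ?mulr0//.
Qed.

Lemma uniq_descendants n I : uniq (descendants n I).
Proof.
elim: n I => [//|n IH] I; rewrite cons_uniq cat_uniq !IH andbT/= mem_cat.
apply/andP; split.
  by apply/orP => -[] /descendants_gen /=; rewrite gerDl.
apply/hasPn => J hr; apply/negP => hl.
have [x Jx] := ditv_nonempty J; have := dind_dleft_dright I x.
have := dind_descendants x hr; have := dind_descendants x hl.
rewrite (dind_eq1 Jx) !mul1r => -> ->; rewrite mulr1 => /eqP.
by rewrite oner_eq0.
Qed.

End dyadic_intervals.

(** * Sums over dyadic trees *)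

Lemma ler_sum_subset {R : realType} (I : eqType) (s t : seq I) (c : I -> R) :
  uniq s -> {subset s <= t} -> (forall i, 0 <= c i) ->
  \sum_(i <- s) c i <= \sum_(i <- t) c i.
Proof.
move=> us st c0; elim: s t us st => [|i s IH] t.
  by rewrite big_nil sumr_ge0.
rewrite cons_uniq => /andP[si us] st.
have it : i \in t by apply: st; rewrite inE eqxx.
rewrite big_cons (perm_big _ (perm_to_rem it))/= big_cons lerD2l.
apply: IH => // j js; have : j \in t by apply: st; rewrite inE js orbT.
rewrite (perm_mem (perm_to_rem it)) inE => /predU1P[ji|//].
by rewrite ji in js; rewrite js in si.
Qed.

Section tree_inequalities.
Context {R : realType}.
Implicit Types (I J : dyadic) (n : nat) (g : dyadic -> R).

Definition tree_sum g n I := \sum_(J <- descendants n I) g J.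

Definition tree_additive g := forall I, g I = g (dleft I) + g (dright I).

Lemma tree_sum0 g I : tree_sum g 0 I = 0.
Proof. by rewrite /tree_sum big_nil. Qed.

Lemma tree_sumS g n I : tree_sum g n.+1 I =
  g I + (tree_sum g n (dleft I) + tree_sum g n (dright I)).
Proof. by rewrite /tree_sum /= big_cons big_cat. Qed.

Lemma tree_sum_ge0 g n I : (forall J, 0 <= g J) -> 0 <= tree_sum g n I.
Proof. by move=> g0; apply: sumr_ge0. Qed.

Lemma tree_sum_le g h n I : (forall J, g J <= h J) ->
  tree_sum g n I <= tree_sum h n I.
Proof. by move=> gh; apply: ler_sum. Qed.

(** Telescoping: the term at a node is paid for by the drop of the potential V from
this node to its two halves, and V is still nonnegative at the leaves. The index
of V is the depth of the tree that remains below. *)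
Lemma tree_sum_potential g (V : nat -> dyadic -> R) :
  (forall I, 0 <= V 0%N I) ->
  (forall n I, g I + (V n (dleft I) + V n (dright I)) <= V n.+1 I) ->
  forall n I, tree_sum g n I <= V n I.
Proof.
move=> V0 VS; elim=> [|n IH] I; first by rewrite tree_sum0.
by rewrite tree_sumS; apply: le_trans (VS n I); rewrite lerD2l lerD.
Qed.

Section square_function.
Variables (sg f Q : dyadic -> R).
Hypotheses (sgD : tree_additive sg) (fD : tree_additive f) (QD : tree_additive Q).
Hypotheses (sg0 : forall I, 0 < sg I) (fQ : forall I, f I ^+ 2 <= Q I * sg I).

Let f2Q I : f I ^+ 2 / sg I <= Q I.
Proof. by rewrite ler_pdivrMr. Qed.

(** The potential is 4A (Q - A f^2 / z), with z the sum of A sg and of the Carleson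
mass of the tree below. As f^2 / z is convex and homogeneous, it does not increase
when (f, z) is replaced with the sum over the two halves of I; z then misses
lam I, and this drop pays for the term at I because z <= 2 A sg. *)
Lemma carleson_embedding (lam : dyadic -> R) (A : R) :
  0 < A -> (forall I, 0 <= lam I) ->
  (forall n I, tree_sum lam n I <= A * sg I) ->
  forall n I, tree_sum (fun J => lam J * (f J / sg J) ^+ 2) n I <= 4 * A * Q I.
Proof.
move=> A0 lam0 lamA n I.
pose z n I := A * sg I + tree_sum lam n I.
have z0 m J : 0 < z m J.
  by rewrite /z ltr_pwDl ?tree_sum_ge0// mulr_gt0.
pose V n I := 4 * A * (Q I - A * (f I ^+ 2 / z n I)).
apply: (@le_trans _ _ (V n I)); last first.
  rewrite /V ler_pM2l ?mulr_gt0// lerBlDr lerDl.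
  by rewrite mulr_ge0 ?(ltW A0)// divr_ge0 ?sqr_ge0// ltW.
apply: tree_sum_potential => [J|m J].
  rewrite /V mulr_ge0 ?mulr_ge0 ?(ltW A0)// subr_ge0 /z tree_sum0 addr0.
  have -> : A * (f J ^+ 2 / (A * sg J)) = f J ^+ 2 / sg J.
    by field; rewrite !gt_eqF.
  exact: f2Q.
rewrite /V; set a := dleft J; set b := dright J.
have zS : z m.+1 J = z m a + z m b + lam J.
  by rewrite /z tree_sumS sgD -/a -/b; ring.
have zle : z m.+1 J <= 2 * A * sg J by have := lamA m.+1 J; rewrite /z; lra.
have za := z0 m a; have zb := z0 m b; have zJ := z0 m.+1 J.
have lJ := lam0 J; have sJ := sg0 J.
set x := z m a in zS za *; set y := z m b in zS zb *; set w := z m.+1 J in zS zle zJ *.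
have fE := fD J; rewrite -/a -/b in fE.
have cs : f J ^+ 2 / (x + y) <= f a ^+ 2 / x + f b ^+ 2 / y.
  rewrite -subr_ge0 fE.
  have -> : f a ^+ 2 / x + f b ^+ 2 / y - (f a + f b) ^+ 2 / (x + y) =
     (f a * y - f b * x) ^+ 2 / (x * y * (x + y)).
    by field; rewrite !gt_eqF// addr_gt0.
  apply: divr_ge0; first exact: sqr_ge0.
  exact: ltW (mulr_gt0 (mulr_gt0 za zb) (addr_gt0 za zb)).
have drop : lam J * (f J / sg J) ^+ 2 <=
    4 * A * A * (f J ^+ 2 / (x + y) - f J ^+ 2 / w).
  have -> : f J ^+ 2 / (x + y) - f J ^+ 2 / w =
     f J ^+ 2 * lam J / ((x + y) * w).
    have xy : x + y != 0 by rewrite gt_eqF// addr_gt0.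
    have -> : lam J = w - (x + y) by rewrite zS; ring.
    by field; rewrite xy gt_eqF.
  have xyw : x + y <= w by rewrite zS lerDl.
  have xy0 : 0 < x + y by rewrite addr_gt0.
  have -> : lam J * (f J / sg J) ^+ 2 =
     4 * A * A * (f J ^+ 2 * lam J / (2 * A * sg J) ^+ 2).
    by field; rewrite !gt_eqF.
  have As : 0 < 2 * A * sg J by rewrite mulr_gt0// mulr_gt0.
  rewrite ler_pM2l ?mulr_gt0//.
  apply: ler_wpM2l; first exact: mulr_ge0 (sqr_ge0 _) lJ.
  rewrite lef_pV2; last 2 first.
  - by rewrite posrE exprn_gt0.
  - by rewrite posrE; exact: mulr_gt0.
  rewrite expr2; apply: ler_pM => //; try exact: ltW.
  exact: le_trans xyw zle.
have := ler_wpM2l (mulr_ge0 (mulr_ge0 (ler0n R 4) (ltW A0)) (ltW A0)) cs.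
by rewrite (QD J) -/a -/b; lra.
Qed.

(** The difference of f between the two halves splits into the difference of
the means f / sg, controlled by the convexity defect of f^2 / sg, and the
difference of sg weighted by the mean, controlled by Carleson embedding. *)
Lemma tree_square_function (r : dyadic -> R) (C A : R) :
  0 <= C -> 0 < A -> (forall I, 0 <= r I) -> (forall I, r I * sg I <= C) ->
  (forall n I, tree_sum (fun J => r J * (sg (dright J) - sg (dleft J)) ^+ 2) n I
     <= A * sg I) ->
  forall n I,
  tree_sum (fun J => r J * (f (dright J) - f (dleft J)) ^+ 2) n I <=
  (2 * C + 8 * A) * Q I.
Proof.
move=> C0 A0 r0 rC lamA n I.
pose lam J := r J * (sg (dright J) - sg (dleft J)) ^+ 2.
have lam0 J : 0 <= lam J by rewrite mulr_ge0 ?sqr_ge0.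
have CE := carleson_embedding A0 lam0 lamA n I.
pose gap J := f (dleft J) ^+ 2 / sg (dleft J) + f (dright J) ^+ 2 / sg (dright J)
  - f J ^+ 2 / sg J.
have gapQ : tree_sum gap n I <= Q I.
  apply: (@le_trans _ _ (Q I - f I ^+ 2 / sg I)); last first.
    by rewrite lerBlDr lerDl divr_ge0 ?sqr_ge0// ltW.
  apply: (tree_sum_potential (V := fun _ J => Q J - f J ^+ 2 / sg J)) => [J|m J].
    by rewrite subr_ge0.
  by rewrite /gap (QD J); lra.
have step J : r J * (f (dright J) - f (dleft J)) ^+ 2 <=
    2 * C * gap J + 2 * (lam J * (f J / sg J) ^+ 2).
  rewrite /gap /lam (fD J) (sgD J).
  have := rC J; rewrite (sgD J).
  have := sg0 (dleft J); have := sg0 (dright J); have := r0 J.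
  set a := sg (dleft J); set b := sg (dright J); set x := f (dleft J); set y := f (dright J).
  set k := r J => k0 b0 a0 kC.
  have ab0 : 0 < a + b by rewrite addr_gt0.
  pose G := x ^+ 2 / a + y ^+ 2 / b - (x + y) ^+ 2 / (a + b).
  pose p := 2 * (a * b) / (a + b) * (y / b - x / a).
  pose q := (x + y) / (a + b) * (b - a).
  (* p carries the jump of the means, q the jump of sg *)
  have -> : y - x = p + q by rewrite /p /q; field; rewrite !gt_eqF.
  have GE : G = a * b / (a + b) * (y / b - x / a) ^+ 2.
    by rewrite /G; field; rewrite !gt_eqF.
  have G0 : 0 <= G.
    by rewrite GE mulr_ge0 ?sqr_ge0// divr_ge0 ?mulr_ge0// ltW.
  have pG : p ^+ 2 = 4 * (a * b) / (a + b) * G.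
    by rewrite GE /p; field; rewrite gt_eqF ?gt_eqF.
  have h : 4 * (a * b) / (a + b) <= a + b.
    by rewrite ler_pdivrMr//; have := sqr_ge0 (a - b); lra.
  have kp : k * p ^+ 2 <= C * G.
    rewrite pG mulrA; apply: ler_wpM2r => //; apply: le_trans kC.
    exact: ler_wpM2l.
  have : k * (p + q) ^+ 2 <= k * (2 * p ^+ 2 + 2 * q ^+ 2).
    by apply: ler_wpM2l => //; have := sqr_ge0 (p - q); lra.
  have -> : k * (b - a) ^+ 2 * ((x + y) / (a + b)) ^+ 2 = k * q ^+ 2.
    by rewrite /q; ring.
  rewrite -/G; lra.
apply: le_trans (tree_sum_le n I step) _.
rewrite /tree_sum big_split/= -!mulr_sumr.
rewrite -/(tree_sum gap n I) -/(tree_sum (fun J => lam J * (f J / sg J) ^+ 2) n I).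
have := ler_wpM2l (mulr_ge0 (ler0n R 2) C0) gapQ; lra.
Qed.

End square_function.

Lemma sum_le_two_trees (s : seq dyadic) g : uniq s -> (forall J, 0 <= g J) ->
  exists i n, \sum_(J <- s) g J <= tree_sum g n (i, 0) + tree_sum g n (i, -1).
Proof.
move=> us g0; have [i [n h]] := finite_family_below s; exists i, n.
by rewrite /tree_sum -big_cat; exact: ler_sum_subset.
Qed.

End tree_inequalities.

Section bellman_carleson.
Context {R : realType}.

(** The function Phi (x, y) = x^2s / y is convex, at most y where x^s <= y, and
its convexity defect between the two halves of a node dominates the squared
jump of y there. *)
Lemma bellman_tree (s C M : R) (x y : dyadic -> R) :
  0 <= C -> convexity_gap s C -> 0 <= M ->
  (forall I, 0 < x I) -> (forall I, 0 < y I) ->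
  (forall I, x I = (x (dleft I) + x (dright I)) / 2) ->
  (forall I, y I = (y (dleft I) + y (dright I)) / 2) ->
  (forall I, x I `^ s <= y I) -> (forall I, y I <= M * x I `^ s) ->
  forall n I, tree_sum (fun J => dlen J * ((y (dright J) - y (dleft J)) ^+ 2 /
     x J `^ s)) n I <= 8 * (1 + C) * M ^+ 3 * (dlen I * y I).
Proof.
move=> C0 gapC M0 x0 y0 xD yD xy yM n I.
set K := 8 * (1 + C) * M ^+ 3.
have K0 : 0 <= K by rewrite !mulr_ge0 ?exprn_ge0// addr_ge0.
pose Phi J := (x J `^ s) ^+ 2 / y J.
have Phi0 J : 0 <= Phi J by rewrite divr_ge0 ?sqr_ge0// ltW.
have Phiy J : Phi J <= y J.
  by rewrite ler_pdivrMr// expr2 ler_pM ?powR_ge0.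
apply: (@le_trans _ _ (K * (dlen I * (y I - Phi I)))); last first.
  apply: ler_wpM2l => //; apply: ler_wpM2l; first exact: ltW (dlen_gt0 I).
  by rewrite lerBlDr lerDl.
apply: (tree_sum_potential (V := fun _ J => K * (dlen J * (y J - Phi J)))).
  move=> J; apply: mulr_ge0 => //; apply: mulr_ge0; last by rewrite subr_ge0.
  exact: ltW (dlen_gt0 J).
move=> _ J; rewrite dlen_dleft dlen_dright.
have := bellman_step C0 gapC (x0 (dright J)) (x0 (dleft J)) (y0 (dright J)) (y0 (dleft J)).
rewrite /= [x _ + x _]addrC -xD [y _ + y _]addrC -yD.
move=> /(_ M (yM J)); rewrite -/K -/(Phi (dright J)) -/(Phi (dleft J)) -/(Phi J) => h.
have := ler_wpM2l (ltW (dlen_gt0 J)) h.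
by rewrite [in y J - _](yD J); lra.
Qed.

End bellman_carleson.

(** * Square-integrable functions *)

Section square_integrable.
Context d {T : measurableType d} {R : realType}.
Variable mu : {measure set T -> \bar R}.
Implicit Types (f g h : T -> R) (a : R).

Local Notation L2 := (Lfun mu 2%:E).

Let one_le_two : (1 <= 2%:E :> \bar R)%E.
Proof. by rewrite lee_fin ler1n. Qed.

Lemma L2_measurable f : f \in L2 -> measurable_fun setT f.
Proof. by rewrite inE => /andP[]; rewrite inE. Qed.

Lemma norm2_sqrt_integral f :
  ('N[mu]_2%:E[EFin \o f] = (\int[mu]_x (f x ^+ 2)%:E) `^ 2^-1)%E.
Proof.
rewrite unlock; congr poweR; apply: eq_integral => x _ /=.
by rewrite powR_mulrn// real_normK// num_real.
Qed.

Lemma L2P f : f \in L2 <->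
  measurable_fun setT f /\ (\int[mu]_x (f x ^+ 2)%:E < +oo)%E.
Proof.
split=> [fL|[mf f2]].
  split; first exact: L2_measurable.
  have /integrableP[_] := Lfun2_integrable_sqr fL; congr (_ < _)%E.
  by apply: eq_integral => x _ /=; rewrite ger0_norm ?sqr_ge0.
apply/andP; split; first by rewrite inE.
rewrite inE/= /finite_norm norm2_sqrt_integral.
exact: poweR_lty.
Qed.

Lemma L2D f g : f \in L2 -> g \in L2 -> (fun x => f x + g x) \in L2.
Proof. by have [_ h] := @Lfun_addr_closed _ _ _ mu _ one_le_two; exact: h. Qed.

Lemma L2Z a f : f \in L2 -> (fun x => a * f x) \in L2.
Proof.
move=> fL; have -> : (fun x => a * f x) = a \o* f.
  by apply/funext => x /=; rewrite mulrC.
by apply: Lfun_scale => //; rewrite ler1n.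
Qed.

Lemma L2B f g : f \in L2 -> g \in L2 -> (fun x => f x - g x) \in L2.
Proof.
move=> fL gL.
rewrite (_ : (fun x => f x - g x) = (fun x => f x + - 1 * g x)).
  exact: L2D fL (L2Z (-1) gL).
by apply/funext => x; rewrite mulN1r.
Qed.

Lemma L2_sum (I : Type) (s : seq I) (a : I -> R) (phi : I -> T -> R) :
  (forall i, phi i \in L2) -> (fun x => \sum_(i <- s) a i * phi i x) \in L2.
Proof.
move=> phiL; elim: s => [|i s IH].
  have -> : (fun x => \sum_(i <- [::]) a i * phi i x) = cst 0.
    by apply/funext => x; rewrite big_nil.
  by have [h _] := @Lfun_addr_closed _ _ _ mu _ one_le_two; exact: h.
rewrite (_ : (fun x => _) =
  (fun x => a i * phi i x + \sum_(j <- s) a j * phi j x)).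
  exact: L2D (L2Z (a i) (phiL i)) IH.
by apply/funext => x; rewrite big_cons.
Qed.

Definition ip f g : R := \int[mu]_x (f x * g x).

Lemma L2_prod_integrable f g : f \in L2 -> g \in L2 ->
  mu.-integrable setT (EFin \o (fun x => f x * g x)).
Proof. by move=> fL gL; apply/Lfun1_integrable; exact: Lfun2_mul_Lfun1. Qed.

Lemma ipC f g : ip f g = ip g f.
Proof. by rewrite /ip; under eq_Rintegral do rewrite mulrC. Qed.

Lemma ipDl f g h : f \in L2 -> g \in L2 -> h \in L2 ->
  ip (fun x => f x + g x) h = ip f h + ip g h.
Proof.
move=> fL gL hL; rewrite /ip -RintegralD//; try exact: L2_prod_integrable.
by under eq_Rintegral do rewrite mulrDl.
Qed.

Lemma ipZl a f h : f \in L2 -> h \in L2 -> ip (fun x => a * f x) h = a * ip f h.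
Proof.
move=> fL hL; rewrite /ip -RintegralZl//; last exact: L2_prod_integrable.
by under eq_Rintegral do rewrite -mulrA.
Qed.

Lemma ipBl f g h : f \in L2 -> g \in L2 -> h \in L2 ->
  ip (fun x => f x - g x) h = ip f h - ip g h.
Proof.
move=> fL gL hL; rewrite /ip -RintegralB//; try exact: L2_prod_integrable.
by under eq_Rintegral do rewrite mulrBl.
Qed.

Lemma ipBr f g h : f \in L2 -> g \in L2 -> h \in L2 ->
  ip h (fun x => f x - g x) = ip h f - ip h g.
Proof. by move=> *; rewrite !(ipC h) ipBl. Qed.

Lemma ip_suml (I : Type) (s : seq I) (a : I -> R) (phi : I -> T -> R) h :
  (forall i, phi i \in L2) -> h \in L2 ->
  ip (fun x => \sum_(i <- s) a i * phi i x) h = \sum_(i <- s) a i * ip (phi i) h.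
Proof.
move=> phiL hL; elim: s => [|i s IH].
  rewrite big_nil /ip; under eq_Rintegral do rewrite big_nil mul0r.
  by rewrite /Rintegral integral0.
rewrite big_cons -IH -ipZl// -ipDl//; [|exact: L2Z|exact: L2_sum].
by rewrite /ip; under eq_Rintegral do rewrite big_cons.
Qed.

Lemma ip_ge0 f : 0 <= ip f f.
Proof. by apply: Rintegral_ge0 => x _; rewrite -expr2 sqr_ge0. Qed.

Lemma ip_integral f g : f \in L2 -> g \in L2 ->
  (\int[mu]_x (f x * g x)%:E = (ip f g)%:E)%E.
Proof.
by move=> fL gL; rewrite fineK//; apply: integrable_fin_num => //; exact: L2_prod_integrable.
Qed.

Lemma ip_integral_sqr f : f \in L2 -> (\int[mu]_x (f x ^+ 2)%:E = (ip f f)%:E)%E.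
Proof. by move=> fL; rewrite -ip_integral//; under eq_integral do rewrite expr2. Qed.

Lemma norm2_ip f : f \in L2 ->
  ('N[mu]_2%:E[EFin \o f] = (Num.sqrt (ip f f))%:E)%E.
Proof.
by move=> fL; rewrite norm2_sqrt_integral ip_integral_sqr// poweR_EFin powR12_sqrt// ip_ge0.
Qed.

Lemma norm2_le f c : 0 <= c -> measurable_fun setT f ->
  ('N[mu]_2%:E[EFin \o f] <= c%:E)%E -> f \in L2 /\ ip f f <= c ^+ 2.
Proof.
move=> c0 mf fc.
have fL : f \in L2.
  by apply/andP; split; rewrite inE//=; exact: le_lt_trans fc (ltry _).
split => //; move: fc; rewrite norm2_ip// lee_fin => fc.
by rewrite -[leLHS]sqr_sqrtr ?ip_ge0// ler_sqr ?nnegrE// sqrtr_ge0.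
Qed.

Lemma norm2_leP f c : 0 <= c -> f \in L2 ->
  (('N[mu]_2%:E[EFin \o f] <= c%:E)%E <-> ip f f <= c ^+ 2).
Proof.
move=> c0 fL; split=> [/(norm2_le c0 (L2_measurable fL))[]//|h].
by rewrite norm2_ip// lee_fin -(ger0_norm c0) -sqrtr_sqr ler_wsqrtr.
Qed.

Lemma ip_quadratic a f g : f \in L2 -> g \in L2 ->
  ip (fun x => a * f x - g x) (fun x => a * f x - g x) =
  a ^+ 2 * ip f f - 2 * a * ip f g + ip g g.
Proof.
move=> fL gL; have aL := L2Z a fL; have bL := L2B aL gL.
rewrite ipBl// ipBr// ipBr// ipZl// ipZl// (ipC f) ipZl// (ipC g) ipZl//.
by ring.
Qed.

Lemma ip_cauchy_schwarz f g : f \in L2 -> g \in L2 ->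
  ip f g ^+ 2 <= ip f f * ip g g.
Proof.
move=> fL gL.
have Q a : 0 <= a ^+ 2 * ip f f - 2 * a * ip f g + ip g g.
  by rewrite -ip_quadratic// ip_ge0.
have := ip_ge0 f; rewrite le_eqVlt => /predU1P[f0|f0].
  have [->|fg] := eqVneq (ip f g) 0; first by rewrite -f0 expr0n/= mul0r.
  have := Q ((ip g g + 1) / (2 * ip f g)); rewrite -f0.
  have -> : 2 * ((ip g g + 1) / (2 * ip f g)) * ip f g = ip g g + 1 by field.
  lra.
have := Q (ip f g / ip f f).
have -> : (ip f g / ip f f) ^+ 2 * ip f f - 2 * (ip f g / ip f f) * ip f g + ip g g
  = (ip f f * ip g g - ip f g ^+ 2) / ip f f by field; rewrite gt_eqF.
by rewrite pmulr_lge0 ?invr_gt0// subr_ge0.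
Qed.

Lemma ip_sub_le f g : f \in L2 -> g \in L2 ->
  ip (fun x => f x - g x) (fun x => f x - g x) <= 2 * ip f f + 2 * ip g g.
Proof.
move=> fL gL.
have /= h a := @ip_quadratic a f g fL gL.
have e1 : ip (fun x => f x - g x) (fun x => f x - g x) =
    ip f f - 2 * ip f g + ip g g.
  have := h 1; rewrite expr1n mul1r mulr1 => <-.
  by rewrite /ip; apply: eq_Rintegral => x _; rewrite !mul1r.
have := ip_ge0 (fun x => - 1 * f x - g x); rewrite h sqrrN expr1n e1; lra.
Qed.

(** * Bessel systems *)

Section bessel.
Variable I : eqType.
Implicit Types (s : seq I) (b : I -> R) (phi : I -> T -> R).

(** The bound is required on finite families only, so that sums of squares need no
convergence statement. *)
Definition bessel phi (K : R) := forall s f, uniq s -> f \in L2 ->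
  \sum_(i <- s) ip f (phi i) ^+ 2 <= K * ip f f.

Definition synthesis phi b s x := \sum_(i <- s) b i * phi i x.

(** The squared norm of a combination S is the sum of the b i <S, phi i>, and the
Bessel inequality at S absorbs the sum of the <S, phi i>^2. *)
Lemma synthesis_bound phi K : 0 < K -> (forall i, phi i \in L2) ->
  bessel phi K -> forall b s, uniq s ->
  ip (synthesis phi b s) (synthesis phi b s) <= K * \sum_(i <- s) b i ^+ 2.
Proof.
move=> K0 phiL B b s us; set S := synthesis phi b s.
have SL : S \in L2 by exact: L2_sum.
have e : ip S S = \sum_(i <- s) b i * ip S (phi i).
  by rewrite [LHS]ip_suml//; apply: eq_bigr => i _; rewrite ipC.
have : ip S S <= \sum_(i <- s) (K * (b i ^+ 2) / 2 + ip S (phi i) ^+ 2 / (2 * K)).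
  rewrite e; apply: ler_sum => i _.
  set p := ip S _; rewrite -subr_ge0.
  have -> : K * b i ^+ 2 / 2 + p ^+ 2 / (2 * K) - b i * p =
    (K * b i - p) ^+ 2 / (2 * K) by field; rewrite gt_eqF.
  by rewrite divr_ge0 ?sqr_ge0// mulr_ge0// ltW.
rewrite big_split/= -!mulr_suml -mulr_sumr => h.
have : (\sum_(i <- s) ip S (phi i) ^+ 2) / (2 * K) <= ip S S / 2.
  rewrite ler_pdivrMr ?mulr_gt0//.
  have -> : ip S S / 2 * (2 * K) = K * ip S S by field.
  exact: B.
lra.
Qed.

(** The combination S of the phi i whose coefficients are those of f satisfies
<f, S> = sum of b i^2; expand the square of K f - S. *)
Lemma bessel_of_synthesis phi K : 0 < K -> (forall i, phi i \in L2) ->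
  (forall b s, uniq s ->
  ip (synthesis phi b s) (synthesis phi b s) <= K * \sum_(i <- s) b i ^+ 2) ->
  bessel phi K.
Proof.
move=> K0 phiL B s f us fL.
pose b i := ip f (phi i); set S := synthesis phi b s.
have SL : S \in L2 by exact: L2_sum.
have e : ip f S = \sum_(i <- s) b i ^+ 2.
  rewrite ipC [LHS]ip_suml//; apply: eq_bigr => i _.
  by rewrite /b ipC expr2.
have := ip_ge0 (fun x => K * f x - S x).
rewrite ip_quadratic// e => h1.
have := B b s us; rewrite -/S => h2.
rewrite -(ler_pM2l K0); rewrite -/(b _); lra.
Qed.

End bessel.

(** * Unconditional convergence in the mean *)

Lemma fatou_ip (u : nat -> T -> R) (g f : T -> R) (c : R) n :
  (forall m, u m \in L2) -> f \in L2 -> measurable_fun setT g ->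
  {ae mu, forall x, u m x @[m --> \oo] --> g x} ->
  (forall m, (n <= m)%N ->
    ip (fun x => u m x - f x) (fun x => u m x - f x) <= c) ->
  (fun x => g x - f x) \in L2 /\ ip (fun x => g x - f x) (fun x => g x - f x) <= c.
Proof.
move=> uL fL mg ug uc.
pose v m x : \bar R := ((u (m + n)%N x - f x) ^+ 2)%:E.
have mf := L2_measurable fL.
have mv m : measurable_fun setT (v m).
  apply/measurable_EFinP; apply: measurable_funX.
  by apply: measurable_funB => //; exact: L2_measurable.
have mgf : measurable_fun setT (fun x => g x - f x) by exact: measurable_funB.
have key : (\int[mu]_x ((g x - f x) ^+ 2)%:E <= c%:E)%E.
  have -> : (\int[mu]_x ((g x - f x) ^+ 2)%:E = \int[mu]_x limn_einf (v ^~ x))%E.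
    apply: ae_eq_integral => //.
    - by apply/measurable_EFinP; exact: measurable_funX.
    - rewrite (_ : (fun x => limn_einf (v ^~ x)) =
        (fun x => - limn_esup (fun m => - v m x))%E); last first.
        by apply/funext => x; rewrite (limn_esupN (v ^~ x)) oppeK.
      apply: measurableT_comp => //; apply: measurable_fun_limn_esup => m.
      exact: measurableT_comp.
    apply: filterS ug => x ux _.
    have cv : v m x @[m --> \oo] --> ((g x - f x) ^+ 2)%:E.
      apply: cvg_EFin; first by near=> m.
      rewrite (_ : fine \o _ = fun m => (u (m + n)%N x - f x) * (u (m + n)%N x - f x))//.
      have := ux; rewrite -(cvg_shiftn n) => h.
      have h' : (u (m + n)%N x - f x) @[m --> \oo] --> g x - f x.
        by apply: cvgB => //; exact: cvg_cst.
      by rewrite expr2; apply: cvgM.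
    rewrite is_cvg_limn_einfE; last by apply/cvg_ex; eexists; exact: cv.
    by apply/esym/cvg_lim.
  apply: le_trans (fatou _ measurableT mv _) _.
    by move=> m x _; rewrite lee_fin sqr_ge0.
  rewrite limn_einf_lim; apply: lime_le.
    exact: is_cvg_einfs.
  apply: nearW => m; apply: ereal_inf_le; exists (\int[mu]_x v m x)%E.
    by exists m => //=.
  have L := L2B (uL (m + n)%N) fL.
  rewrite /v ip_integral_sqr// lee_fin; apply: uc; exact: leq_addl.
have gL : (fun x => g x - f x) \in L2.
  by apply/L2P; split => //; exact: le_lt_trans key (ltry _).
by split => //; rewrite -lee_fin -ip_integral_sqr.
Unshelve. all: by end_near. Qed.

(** Since |D n| <= (1/2)^n + 2^n (D n)^2, the series converges absolutely wherever
the sum of the 2^n (D n)^2 is finite, and this sum has a finite integral. The limit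
is given as an upper limit, which is measurable whether or not there is
convergence. *)
Lemma ae_series_cvg (D : nat -> T -> R) (K : R) :
  (forall n, D n \in L2) -> (forall n, ip (D n) (D n) <= K * (1 / 4) ^+ n) ->
  exists2 g : T -> R, measurable_fun setT g &
    {ae mu, forall x, \sum_(k < n) D k x @[n --> \oo] --> g x}.
Proof.
move=> DL DK.
pose q n x : \bar R := (2 ^+ n * D n x ^+ 2)%:E.
have q0 n x : (0 <= q n x)%E by rewrite lee_fin mulr_ge0 ?sqr_ge0 ?exprn_ge0.
have mD n := L2_measurable (DL n).
have mq n : measurable_fun setT (q n).
  by apply/measurable_EFinP; apply: measurable_funM => //; exact: measurable_funX.
have mQ : measurable_fun setT (fun x => \sum_(n <oo) q n x)%E.
  by apply: ge0_emeasurable_sum => // n x _ _.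
have iQ : mu.-integrable setT (fun x => \sum_(n <oo) q n x)%E.
  apply/integrableP; split => //.
  under eq_integral do rewrite gee0_abs ?nneseries_ge0//.
  rewrite integral_nneseries//.
  apply: (@le_lt_trans _ _ (\sum_(n <oo) (K * (1 / 2) ^+ n)%:E)%E).
    apply: lee_nneseries => n _; first by move=> _; exact: integral_ge0.
    rewrite /q; under eq_integral do rewrite EFinM.
    rewrite ge0_integralZl_EFin//; last 2 first.
    - by move=> x _; rewrite lee_fin sqr_ge0.
    - by apply/measurable_EFinP; exact: measurable_funX.
    rewrite ip_integral_sqr// -EFinM lee_fin.
    have -> : K * (1 / 2) ^+ n = 2 ^+ n * (K * (1 / 4) ^+ n).
      by rewrite mulrCA -exprMn; congr (_ * _ ^+ _); field.
    by apply: ler_wpM2l => //; exact: exprn_ge0.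
  have -> : (\sum_(n <oo) (K * (1 / 2) ^+ n)%:E = (2 * K)%:E)%E.
    have /cvg_lim := @cvg_geometric_eseries_half R (2 * K) 0.
    rewrite expr0 divr1 => <- //; congr (limn _); apply/funext => n.
    rewrite /eseries/=; apply: eq_bigr => k _; congr EFin.
    by rewrite addn1 natrX exprS expr_div_n expr1n; field; rewrite expf_neq0// pnatr_eq0.
  exact: ltry.
pose S n x := \sum_(k < n) D k x.
have mS n : measurable_fun setT (S n) by exact: measurable_sum.
exists (fun x => fine (limn_esup (fun n => (S n x)%:E))).
  apply: measurableT_comp => //; apply: measurable_fun_limn_esup => n.
  by apply/measurable_EFinP; exact: mS.
apply: filterS (integrable_ae measurableT iQ) => x /(_ I) Qx.
have cq : cvgn (series (fun n => 2 ^+ n * D n x ^+ 2)).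
  apply: nnseries_is_cvg => [n|]; first by rewrite mulr_ge0 ?sqr_ge0 ?exprn_ge0.
  rewrite -ge0_fin_numE; first exact: Qx.
  by apply: nneseries_ge0 => n _ _; exact: (q0 n x).
have cg : cvgn (series (geometric (1 : R) (1 / 2))).
  by apply: is_cvg_geometric_series; rewrite ger0_norm; lra.
have cD : cvgn (series (fun n => D n x)).
  apply: normed_cvg; apply: (series_le_cvg _ _ _ (is_cvg_seriesD cg cq)) => n //=.
    apply: addr_ge0; last by rewrite mulr_ge0 ?sqr_ge0 ?exprn_ge0.
    by rewrite /geometric/= mulr_ge0 ?ler01// exprn_ge0// divr_ge0.
  suff : `|D n x| <= (1 / 2) ^+ n + 2 ^+ n * D n x ^+ 2.
    by rewrite -[(1 / 2) ^+ n]mul1r.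
  set a := D n x; have a2 : a ^+ 2 = `|a| ^+ 2 by rewrite real_normK// num_real.
  set h := (1 / 2) ^+ n; have h0 : 0 < h by rewrite exprn_gt0//; lra.
  have -> : 2 ^+ n = h^-1 :> R by rewrite /h expr_div_n expr1n div1r invrK.
  rewrite -(ler_pM2l h0) mulrDr mulrA mulfV ?gt_eqF// mul1r a2.
  by have := sqr_ge0 (h - `|a|); have := normr_ge0 a; nra.
have Sx n : series (fun n => D n x) n = S n x by rewrite /series/= big_mkord.
have cS : S n x @[n --> \oo] --> limn (series (fun n => D n x)).
  by have := cD; rewrite (_ : series _ = S ^~ x)//; apply/funext => n.
have cE : (S n x)%:E @[n --> \oo] --> (limn (series (fun n => D n x)))%:E.
  by apply: cvg_EFin => //; near=> n.
rewrite is_cvg_limn_esupE; last by apply/cvg_ex; eexists; exact: cE.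
by rewrite (cvg_lim _ cE).
Unshelve. all: by end_near. Qed.

Section unconditional_convergence.
Variable I : choiceType.
Implicit Types (s t : seq I) (b : I -> R) (phi : I -> T -> R).

(** The families E n are built so as to come within 4^-n of the supremum of the
finite sums; by maximality what lies outside E n.+1 adds up to at most 4^-n. *)
Lemma exhausting_families (c : I -> R) (B : R) : (forall i, 0 <= c i) ->
  (forall s, uniq s -> \sum_(i <- s) c i <= B) ->
  exists E D : nat -> seq I, [/\ forall n, E n.+1 = E n ++ D n, E 0%N = [::],
    forall n, uniq (E n) &
    forall n s, uniq s -> {in s, forall i, i \notin E n.+1} ->
      \sum_(i <- s) c i <= (1 / 4) ^+ n].
Proof.
move=> c0 cB.
pose A := [set \sum_(i <- s) c i | s in [set s | uniq s]].
have supA : has_sup A.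
  split; first by exists 0; exists [::] => //; rewrite big_nil.
  by exists B => _ [s us <-]; exact: cB.
have /choice[F FP] : forall n, exists s, uniq s /\
    sup A - (1 / 4) ^+ n < \sum_(i <- s) c i.
  move=> n; have e0 : 0 < (1 / 4) ^+ n :> R by rewrite exprn_gt0//; lra.
  by have [_ [s us <-] h] := sup_adherent e0 supA; exists s.
pose E := fix E n := if n is m.+1 then
  E m ++ [seq i <- F m | i \notin E m] else [::].
have uE n : uniq (E n).
  elim: n => [//|n IH] /=; rewrite cat_uniq IH/= filter_uniq ?andbT//.
    by apply/hasPn => i; rewrite mem_filter => /andP[].
  by have [] := FP n.
exists E, (fun n => [seq i <- F n | i \notin E n]); split => // n s us sE.
have [uF hF] := FP n.
have h1 : \sum_(i <- F n) c i <= \sum_(i <- E n.+1) c i.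
  apply: ler_sum_subset => // i iF; rewrite /= mem_cat mem_filter iF andbT.
  by case: (i \in E n).
have h2 : \sum_(i <- s) c i + \sum_(i <- E n.+1) c i <= sup A.
  rewrite -big_cat; apply: (ub_le_sup supA.2); exists (s ++ E n.+1) => //=.
  rewrite cat_uniq us (uE n.+1) andbT/=; apply/hasPn => i iE.
  by apply: contraL iE => /sE.
lra.
Qed.

(** The sums over exhausting families converge almost everywhere, hence in the mean
by Fatou's lemma; a sum over any larger family s differs from them by sums over
families that miss E n.+1. *)
Theorem synthesis_converges phi (K B : R) b : 0 < K ->
  (forall i, phi i \in L2) -> bessel phi K ->
  (forall s, uniq s -> \sum_(i <- s) b i ^+ 2 <= B) ->
  exists g : T -> R, [/\ g \in L2, ip g g <= K * B &
    forall eps, 0 < eps -> exists s0 : seq I, forall s, uniq s ->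
      {subset s0 <= s} ->
      (fun x => g x - synthesis phi b s x) \in L2 /\
      ip (fun x => g x - synthesis phi b s x)
         (fun x => g x - synthesis phi b s x) <= eps].
Proof.
move=> K0 phiL Bphi bB.
have SB := synthesis_bound K0 phiL Bphi b.
have SL s : synthesis phi b s \in L2 by exact: L2_sum.
have [E [D [ES E0 uE tail]]] := exhausting_families (fun i => sqr_ge0 (b i)) bB.
have uD n : uniq (D n) by have := uE n.+1; rewrite ES cat_uniq => /and3P[].
have DE n i : i \in D n -> i \notin E n.
  move=> iD; have := uE n.+1; rewrite ES cat_uniq => /and3P[_ /hasPn h _].
  exact: h.
(* D is shifted since nothing bounds the sum over D 0 by a power of 1/4 *)
have [||g mg cg] := @ae_series_cvg (fun n => synthesis phi b (D n.+1)) K.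
- by move=> n; exact: SL.
- move=> n; apply: le_trans (SB _ (uD n.+1)) _; rewrite ler_pM2l//.
  by apply: tail => // i; exact: DE.
have synth0 x : synthesis phi b [::] x = 0 by rewrite /synthesis big_nil.
pose u m := synthesis phi b (E m.+1).
pose G x := g x + u 0%N x.
have mG : measurable_fun setT G.
  by apply: measurable_funD => //; exact: L2_measurable (SL _).
have uG : {ae mu, forall x, u m x @[m --> \oo] --> G x}.
  apply: filterS cg => x cgx.
  rewrite (_ : (fun m => u m x) =
    fun m => \sum_(k < m) synthesis phi b (D k.+1) x + u 0%N x).
    by apply: cvgD => //; exact: cvg_cst.
  apply/funext => m; elim: m => [|m IH]; first by rewrite big_ord0 add0r.
  rewrite big_ord_recr/= addrAC -IH /u (ES m.+1).
  by rewrite /synthesis big_cat.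
have EW n m : (n <= m)%N -> {subset E n <= E m}.
  elim: m => [|m IH]; first by rewrite leqn0 => /eqP->.
  rewrite leq_eqVlt => /predU1P[->//|]; rewrite ltnS => /IH h i /h.
  by rewrite ES mem_cat => ->.
have bound0 m : ip (fun x => u m x - synthesis phi b [::] x)
     (fun x => u m x - synthesis phi b [::] x) <= K * B.
  rewrite (_ : (fun x => _) = u m); last by apply/funext => x; rewrite synth0 subr0.
  by apply: le_trans (SB _ (uE m.+1)) _; rewrite ler_pM2l// bB.
have [] := @fatou_ip u G (synthesis phi b [::]) (K * B) 0 (fun m => SL _) (SL _) mG uG
  (fun m _ => bound0 m).
rewrite (_ : (fun x => _) = G); last by apply/funext => x; rewrite synth0 subr0.
move=> GL GB; exists G; split => // eps eps0.
pose e := eps / (4 * K); have e0 : 0 < e by rewrite divr_gt0// mulr_gt0.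
have [n hn] : exists n, (1 / 4) ^+ n <= e.
  exists (Num.bound e^-1).
  rewrite expr_div_n expr1n div1r -[leRHS]invrK lef_pV2; last 2 first.
  - by rewrite posrE exprn_gt0.
  - by rewrite posrE invr_gt0.
  apply: ltW; apply: lt_le_trans (archi_boundP _) _; first by rewrite invr_ge0 ltW.
  by rewrite -natrX ler_nat ltnW// ltn_expl.
exists (E n.+1) => s us Es.
have close m : (n <= m)%N -> ip (fun x => u m x - synthesis phi b s x)
     (fun x => u m x - synthesis phi b s x) <= eps.
  move=> nm; pose s1 := [seq i <- E m.+1 | i \notin s].
  pose s2 := [seq i <- s | i \notin E m.+1].
  have us1 : uniq s1 by rewrite filter_uniq.
  have us2 : uniq s2 by rewrite filter_uniq.
  have -> : (fun x => u m x - synthesis phi b s x) =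
      (fun x => synthesis phi b s1 x - synthesis phi b s2 x).
    apply/funext => x; rewrite /u /synthesis /s1 /s2 !big_filter.
    rewrite (bigID (mem s))/= [in X in _ - X](bigID (mem (E m.+1)))/=.
    rewrite -[in X in X + _ - _]big_filter -[in X in _ - (X + _)]big_filter.
    have pE : perm_eq [seq i <- E m.+1 | i \in s] [seq i <- s | i \in E m.+1].
      apply: uniq_perm; rewrite ?filter_uniq// => i.
      by rewrite !mem_filter andbC.
    rewrite (perm_big _ pE)/=.
    by ring.
  apply: le_trans (ip_sub_le (SL _) (SL _)) _.
  have t1 : \sum_(i <- s1) b i ^+ 2 <= e.
    apply: le_trans hn; apply: tail => // i; rewrite mem_filter => /andP[nis _].
    by apply: contra nis; exact: Es.
  have t2 : \sum_(i <- s2) b i ^+ 2 <= e.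
    apply: le_trans hn; apply: tail => // i; rewrite mem_filter => /andP[niE _].
    by apply: contra niE; apply: EW; rewrite ltnS.
  have q1 := le_trans (SB _ us1) (ler_wpM2l (ltW K0) t1).
  have q2 := le_trans (SB _ us2) (ler_wpM2l (ltW K0) t2).
  have -> : eps = 4 * (K * e) by rewrite /e; field; rewrite gt_eqF.
  lra.
exact: fatou_ip (fun m => SL _) (SL _) mG uG close.
Qed.

End unconditional_convergence.

End square_integrable.

(** * Haar functions modulated by a locally square-integrable function *)

Section haar_system.
Context {R : realType}.
Local Notation mu := (@lebesgue_measure R).
Local Notation L2 := (Lfun mu 2%:E).
Local Notation ip := (ip mu).
Implicit Types (f g v : R -> R) (I J : dyadic) (x : R).

Lemma measurable_dind J : measurable_fun setT (dind J : R -> R).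
Proof. by apply: measurable_indic; exact: measurable_ditv. Qed.

Lemma integral_dind J : (\int[mu]_x (dind J x)%:E = (dlen J)%:E)%E.
Proof.
rewrite (integral_indic mu measurableT (measurable_ditv J)) setIT.
exact: mu_ditv.
Qed.

Lemma dind_L2 J : (dind J : R -> R) \in L2.
Proof.
apply/L2P; split; first exact: measurable_dind.
under eq_integral do rewrite dind_sqr.
by rewrite integral_dind ltry.
Qed.

Lemma restrict_L2 f J : f \in L2 -> (fun x => f x * dind J x) \in L2.
Proof.
move=> fL; apply/L2P; split.
  by apply: measurable_funM; [exact: L2_measurable fL|exact: measurable_dind].
have /L2P[_ f2] := fL; apply: le_lt_trans f2; apply: ge0_le_integral => //=.
- by move=> x _; rewrite lee_fin sqr_ge0.
- apply/measurable_EFinP; apply: measurable_funX.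
  by apply: measurable_funM; [exact: L2_measurable fL|exact: measurable_dind].
- by apply/measurable_EFinP; apply: measurable_funX; exact: L2_measurable fL.
move=> x _; rewrite lee_fin exprMn dind_sqr ler_piMr ?sqr_ge0//.
by rewrite dindE lern1 leq_b1.
Qed.

Definition locally_L2 v := forall J, (fun x => v x * dind J x) \in L2.

(** Restricting the integrand rather than the domain keeps all the integrals on the
line, where the rules for [ip] apply. *)
Definition local_ip f g J : R := \int[mu]_x (f x * g x * dind J x).

Lemma local_ipE f g J : local_ip f g J =
  ip (fun x => f x * dind J x) (fun x => g x * dind J x).
Proof.
apply: eq_Rintegral => x _; rewrite -[in LHS](dind_sqr J x); ring.
Qed.

Lemma local_ip_ipr f g J : local_ip f g J = ip f (fun x => g x * dind J x).
Proof. by apply: eq_Rintegral => x _; rewrite mulrA. Qed.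

Lemma local_ip_integrable f g J : locally_L2 f -> locally_L2 g ->
  mu.-integrable setT (EFin \o (fun x => f x * g x * dind J x)).
Proof.
move=> fL gL; have := L2_prod_integrable (fL J) (gL J).
congr (integrable _ _ _); apply/funext => x /=; congr EFin.
by rewrite -[in RHS](dind_sqr J x); ring.
Qed.

Lemma local_ip_additive f g : locally_L2 f -> locally_L2 g ->
  tree_additive (local_ip f g).
Proof.
move=> fL gL I; rewrite /local_ip -RintegralD//; try exact: local_ip_integrable.
by apply: eq_Rintegral => x _; rewrite (dind_halves I) mulrDr.
Qed.

Lemma L2_locally f : f \in L2 -> locally_L2 f.
Proof. by move=> fL J; exact: restrict_L2. Qed.

(** The intervals [0, 2^-i[ and [-2^-i, 0[ are disjoint. *)
Lemma local_ip_two_origins f i : f \in L2 ->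
  local_ip f f (i, 0) + local_ip f f (i, -1) <= ip f f.
Proof.
move=> fL; have fl := L2_locally fL.
rewrite /local_ip -RintegralD//; try exact: local_ip_integrable.
apply: le_Rintegral => //.
- have := integrableD measurableT (local_ip_integrable (i, 0) fl fl)
    (local_ip_integrable (i, -1) fl fl).
  by apply: eq_integrable.
- exact: L2_prod_integrable.
move=> x _; rewrite -mulrDr ler_piMr// -?expr2 ?sqr_ge0//.
have ne : (i, 0) != (i, -1) :> dyadic by rewrite xpair_eqE eqxx.
have := @dind_same_gen R (i, 0) (i, -1) x erefl ne.
rewrite !dindE; do 2!case: (_ == _); rewrite ?mulr0 ?mulr1 ?addr0 ?add0r//.
by move/eqP; rewrite oner_eq0.
Qed.

Lemma haarE J x : haar J x =
  (Num.sqrt (dlen J))^-1 * (dind (dright J) x - dind (dleft J) x).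
Proof. by []. Qed.

Lemma haar_L2 J : (haar J : R -> R) \in L2.
Proof. by apply: L2Z; apply: L2B; exact: dind_L2. Qed.

Lemma sqr_sqrt_dlen J : (Num.sqrt (dlen J))^-1 ^+ 2 = (dlen J)^-1 :> R.
Proof. by rewrite exprVn sqr_sqrtr// ltW// dlen_gt0. Qed.

Lemma mul_haar_L2 v J : locally_L2 v -> (fun x => v x * haar J x) \in L2.
Proof.
move=> vL; rewrite (_ : (fun x => _) = fun x => (Num.sqrt (dlen J))^-1 *
   (v x * dind (dright J) x - v x * dind (dleft J) x)).
  by apply: L2Z; apply: L2B; exact: vL.
by apply/funext => x; rewrite haarE; ring.
Qed.

Lemma ip_mul_haar f v J : f \in L2 -> locally_L2 v ->
  ip f (fun x => v x * haar J x) = (Num.sqrt (dlen J))^-1 *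
    (local_ip f v (dright J) - local_ip f v (dleft J)).
Proof.
move=> fL vL; rewrite !local_ip_ipr -ipBr// ipC -[in RHS]ipC -ipZl//; last exact: L2B.
by apply: eq_Rintegral => x _; rewrite haarE; ring.
Qed.

(** The coefficient of f on v h_J is a difference of integrals of f v over the halves
of J; [tree_square_function] applies to these integrals and to those of v^2, in two
trees at the origin that cover the finite family. *)
Theorem modulated_haar_bessel v (kap : dyadic -> R) (C A : R) :
  locally_L2 v -> (forall J, 0 < local_ip v v J) -> 0 <= C -> 0 < A ->
  (forall J, kap J ^+ 2 / dlen J * local_ip v v J <= C) ->
  (forall n I, tree_sum (fun J => kap J ^+ 2 / dlen J *
     (local_ip v v (dright J) - local_ip v v (dleft J)) ^+ 2) n I
     <= A * local_ip v v I) ->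
  bessel mu (fun J x => kap J * (v x * haar J x)) (2 * C + 8 * A).
Proof.
move=> vL v0 C0 A0 vC vA s f us fL.
have fl := L2_locally fL.
pose term J := kap J ^+ 2 / dlen J *
  (local_ip f v (dright J) - local_ip f v (dleft J)) ^+ 2.
have r0 J : 0 <= kap J ^+ 2 / dlen J.
  by rewrite divr_ge0 ?sqr_ge0// ltW// dlen_gt0.
have -> : \sum_(J <- s) ip f (fun x => kap J * (v x * haar J x)) ^+ 2 =
    \sum_(J <- s) term J.
  apply: eq_bigr => J _; rewrite ipC ipZl//; last exact: mul_haar_L2.
  by rewrite (ipC mu _ f) ip_mul_haar// !exprMn sqr_sqrt_dlen mulrA.
have term0 J : 0 <= term J by rewrite mulr_ge0 ?sqr_ge0.
have [i [n h]] := sum_le_two_trees us term0.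
apply: le_trans h _.
have cs J : local_ip f v J ^+ 2 <= local_ip f f J * local_ip v v J.
  by rewrite !local_ipE; exact: ip_cauchy_schwarz.
have T := tree_square_function (local_ip_additive vL vL) (local_ip_additive fl vL)
  (local_ip_additive fl fl) v0 cs C0 A0 r0 vC vA n.
apply: le_trans (lerD (T (i, 0)) (T (i, -1))) _.
rewrite -mulrDr; apply: ler_wpM2l; first by lra.
exact: local_ip_two_origins.
Qed.

Lemma Rintegral_dind J : \int[mu]_x dind J x = dlen J.
Proof. by rewrite /Rintegral integral_dind. Qed.

Lemma ip_haar_self J : ip (haar J) (haar J) = 1.
Proof.
rewrite (_ : ip _ _ = ip (fun x => (dlen J)^-1 * dind J x) (dind J)).
  rewrite ipZl ?dind_L2// -(_ : \int[mu]_x dind J x = ip (dind J) (dind J)).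
    by rewrite Rintegral_dind mulVf// gt_eqF// dlen_gt0.
  by apply: eq_Rintegral => x _; rewrite -expr2 dind_sqr.
apply: eq_Rintegral => x _; rewrite -[RHS]mulrA -[in RHS]expr2 dind_sqr !haarE.
rewrite (dind_halves J) -(sqr_sqrt_dlen J).
have := dind_dleft_dright J x.
have := @dind_sqr R (dleft J) x; have := @dind_sqr R (dright J) x.
set a := dind (dleft J) x; set b := dind (dright J) x; set c := _^-1.
move=> b2 a2 ab.
have -> : c * (b - a) * (c * (b - a)) = c ^+ 2 * (b ^+ 2 + a ^+ 2 - 2 * (a * b)).
  by ring.
by rewrite a2 b2 ab mulr0 subr0 addrC.
Qed.

Lemma dind_integrable J : mu.-integrable setT (EFin \o (dind J : R -> R)).
Proof.
have := L2_prod_integrable (dind_L2 J) (dind_L2 J).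
by congr (integrable _ _ _); apply/funext => x /=; rewrite -expr2 dind_sqr.
Qed.

Lemma Rintegral_haar J : \int[mu]_x haar J x = 0.
Proof.
rewrite RintegralZl//; last first.
  by apply: (integrableB measurableT (dind_integrable (dright J)) (dind_integrable (dleft J))).
rewrite RintegralB//; last 2 first.
- exact: dind_integrable.
- exact: dind_integrable.
have e K : \int[mu]_x \1_(ditv K) x = dlen K by exact: Rintegral_dind.
by rewrite !e dlen_dleft dlen_dright subrr mulr0.
Qed.

Lemma haar_dind J x : haar J x * dind J x = haar J x.
Proof.
rewrite haarE -mulrA mulrBl !dind_half//; first by left.
by right.
Qed.

(** The function of the larger interval is constant on the smaller one, on which
the other one has integral 0. *)
Lemma ip_haar_neq I J : I != J -> ip (haar I) (haar J) = 0.
Proof.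
wlog IJ : I J / I.1 <= J.1.
  move=> W nIJ; case/orP: (le_total I.1 J.1) => h; first exact: W.
  by rewrite ipC W// eq_sym.
move=> nIJ.
suff [c hc] : exists c, forall x, haar I x * haar J x = c * haar J x.
  rewrite /ip; under eq_Rintegral do rewrite hc.
  rewrite RintegralZl// ?Rintegral_haar ?mulr0//.
  have := L2_prod_integrable (haar_L2 J) (dind_L2 J).
  by congr (integrable _ _ _); apply/funext => x /=; rewrite haar_dind.
have [[n hn]|dis] := @dyadic_dichotomy R I J IJ; last first.
  exists 0 => x; rewrite mul0r -haar_dind -(haar_dind J).
  have -> : haar I x * dind I x * (haar J x * dind J x) =
     haar I x * haar J x * (dind J x * dind I x) by ring.
  by rewrite dis mulr0.
case: n hn => // n; rewrite /= inE eq_sym (negPf nIJ)/= mem_cat.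
move=> /orP[] h.
- exists (- (Num.sqrt (dlen I))^-1) => x.
  rewrite -[haar J x]haar_dind -(dind_descendants x h) haarE.
  have := dind_dleft_dright I x; have := @dind_sqr R (dleft I) x.
  set a := dind (dleft I) x; set b := dind (dright I) x; set c := _^-1.
  set u := haar J x; set v := dind J x => a2 ab.
  have -> : c * (b - a) * (u * (v * a)) = c * (u * v) * (a * b - a ^+ 2) by ring.
  by rewrite ab a2; ring.
exists ((Num.sqrt (dlen I))^-1) => x.
rewrite -[haar J x]haar_dind -(dind_descendants x h) haarE.
have := dind_dleft_dright I x; have := @dind_sqr R (dright I) x.
set a := dind (dleft I) x; set b := dind (dright I) x; set c := _^-1.
set u := haar J x; set v := dind J x => b2 ab.
have -> : c * (b - a) * (u * (v * b)) = c * (u * v) * (b ^+ 2 - a * b) by ring.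
by rewrite ab b2; ring.
Qed.

Lemma ip_haar_synthesis (b : dyadic -> R) s J : uniq s ->
  ip (synthesis haar b s) (haar J) = if J \in s then b J else 0.
Proof.
move=> us; rewrite [LHS]ip_suml; [|exact: haar_L2|exact: haar_L2].
have -> : \sum_(i <- s) b i * ip (haar i) (haar J) =
    \sum_(i <- s) (if i == J then b J else 0).
  apply: eq_bigr => i _; case: eqVneq => [->|h]; first by rewrite ip_haar_self mulr1.
  by rewrite ip_haar_neq// mulr0.
case: ifPn => Js.
  rewrite (bigD1_seq J)//= eqxx big1 ?addr0// => i /negPf->//.
by rewrite big1_seq// => i /= is_; case: eqVneq => // ij; rewrite -ij is_ in Js.
Qed.

Lemma ip_synthesis_self (b : dyadic -> R) s : uniq s ->
  ip (synthesis haar b s) (synthesis haar b s) = \sum_(i <- s) b i ^+ 2.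
Proof.
move=> us; rewrite [LHS]ip_suml; [|exact: haar_L2|apply: L2_sum; exact: haar_L2].
by apply: eq_big_seq => i is_; rewrite ipC ip_haar_synthesis// is_ expr2.
Qed.

Lemma haar_bessel : bessel mu haar 1.
Proof.
apply: bessel_of_synthesis => //; first exact: haar_L2.
by move=> b s us; rewrite ip_synthesis_self// mul1r.
Qed.

(** * Boundedness of the multiplier as a Bessel inequality *)

Definition haar_atom (w : R -> R) (t : R) J x := (w x / avg w J) `^ t * haar J x.

Lemma haar_mult_sumE w t (F : {fset dyadic}) f x :
  haar_mult_sum w t F f x = synthesis (haar_atom w t) (haar_coef f) F x.
Proof. by apply: eq_bigr => J _; rewrite /haar_atom; ring. Qed.

(** The coefficients of f are square summable by [haar_bessel], so that
[synthesis_converges] applies. *)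
Lemma haar_mult_bound_of_bessel w t (K : R) : 0 < K ->
  (forall J, haar_atom w t J \in L2) -> bessel mu (haar_atom w t) K ->
  haar_mult_bound w t (Num.sqrt K).
Proof.
move=> K0 aL aB; split; first exact: sqrtr_ge0.
move=> f fL.
have fB s : uniq s -> \sum_(J <- s) haar_coef f J ^+ 2 <= ip f f.
  by move=> us; have := haar_bessel us fL; rewrite mul1r.
have [g [gL gK gc]] := synthesis_converges K0 aL aB fB.
exists g.
  split => // eps eps0.
  have [s0 h0] := gc _ (exprn_gt0 2 eps0).
  exists [fset J in s0]%fset => F /fsubsetP F0F.
  have [|SL Se] := h0 F (fset_uniq F).
    by move=> J Js; apply: F0F; rewrite inE.
  rewrite /norm2 (_ : (g \- _)%R =
     (fun x => g x - synthesis (haar_atom w t) (haar_coef f) F x)).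
    by apply/norm2_leP => //; exact: ltW.
  by apply/funext => x /=; rewrite haar_mult_sumE.
rewrite /norm2 !norm2_ip// -EFinM lee_fin -(sqrtrM _ (ltW K0)).
by rewrite ler_wsqrtr.
Qed.

Lemma measurable_haar_atom w t J : measurable_fun setT w ->
  measurable_fun setT (haar_atom w t J).
Proof.
move=> mw; apply: measurable_funM; last exact: L2_measurable (haar_L2 J).
apply: (measurableT_comp (measurable_powR t)).
by apply: measurable_funM.
Qed.

(** All large enough partial sums of T f, for f a finite Haar sum, are the same
finite combination S of atoms, so that their limit g is S almost everywhere. *)
Lemma synthesis_of_haar_mult_bound w t (K : R) : measurable_fun setT w ->
  haar_mult_bound w t K -> forall (b : dyadic -> R) s, uniq s ->
  synthesis (haar_atom w t) b s \in L2 /\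
  ip (synthesis (haar_atom w t) b s) (synthesis (haar_atom w t) b s) <=
    K ^+ 2 * \sum_(J <- s) b J ^+ 2.
Proof.
move=> mw [K0 TK] b s us; set S := synthesis (haar_atom w t) b s.
pose f := synthesis haar b s.
have fL : f \in L2 by apply: L2_sum; exact: haar_L2.
have [g [gL gc] gK] := TK f fL.
have mS : measurable_fun setT S.
  by apply: measurable_sum => J; apply: measurable_funM => //; exact: measurable_haar_atom.
have gS eps : 0 < eps -> (norm2 (fun x => g x - S x)%R <= eps%:E)%E.
  move=> /gc[F0 hF]; have := hF (F0 `|` [fset J in s])%fset (fsubsetUl _ _).
  set F := (F0 `|` _)%fset; rewrite (_ : (g \- _)%R = (fun x => g x - S x))//.
  apply/funext => x /=; rewrite haar_mult_sumE; congr (_ - _).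
  have -> : synthesis (haar_atom w t) (haar_coef f) F x =
     \sum_(J <- F | J \in s) b J * haar_atom w t J x.
    rewrite big_mkcond; apply: eq_bigr => J _.
    have -> : haar_coef f J = if J \in s then b J else 0.
      exact: ip_haar_synthesis.
    by case: ifP => // _; rewrite mul0r.
  rewrite -big_filter; apply: perm_big; apply: uniq_perm => //.
    by rewrite filter_uniq// fset_uniq.
  move=> J; rewrite mem_filter in_fsetU inE/=.
  by case: (J \in s); rewrite ?orbT.
have md : measurable_fun setT (fun x => g x - S x).
  by apply: measurable_funB => //; exact: L2_measurable gL.
have dL : (fun x => g x - S x) \in L2.
  by have [] := norm2_le (mu := mu) ler01 md (gS 1 ltr01).
set d := fun x => g x - S x in md dL gS.
have SE : S = fun x => g x - d x by apply/funext => x; rewrite /d; ring.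
have SL : S \in L2 by rewrite SE; exact: L2B.
split => //.
have d0 : ip d d = 0.
  apply/eqP; rewrite eq_le ip_ge0 andbT; apply/ler_addgt0Pr => e e0; rewrite add0r.
  have q0 : 0 < Num.sqrt e by rewrite sqrtr_gt0.
  have [_] := norm2_le (mu := mu) (ltW q0) md (gS _ q0).
  by rewrite sqr_sqrtr// ltW.
have gd : ip g d = 0.
  apply/eqP; rewrite -sqrf_eq0 eq_le sqr_ge0 andbT.
  by have := ip_cauchy_schwarz gL dL; rewrite d0 mulr0.
have -> : ip S S = ip g g.
  have GL := L2B gL dL.
  by rewrite SE (ipBl gL dL GL) (ipBr gL dL gL) (ipBr gL dL dL) d0 (ipC mu d) gd !subr0.
have : (norm2 g <= (K * Num.sqrt (ip f f))%:E)%E.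
  by rewrite EFinM -norm2_ip.
move/(norm2_leP (mu := mu) (mulr_ge0 K0 (sqrtr_ge0 _)) gL).
by rewrite exprMn sqr_sqrtr ?ip_ge0// ip_synthesis_self.
Qed.

Lemma haar_atom_L2 w t K J : measurable_fun setT w ->
  haar_mult_bound w t K -> haar_atom w t J \in L2.
Proof.
move=> mw TK.
have [] := synthesis_of_haar_mult_bound mw TK (fun=> 1) (s := [:: J]) isT.
rewrite (_ : synthesis _ _ _ = haar_atom w t J)//.
by apply/funext => x; rewrite /synthesis big_seq1 mul1r.
Qed.

Lemma ip_haar_atom_le w t K J : measurable_fun setT w ->
  haar_mult_bound w t K -> ip (haar_atom w t J) (haar_atom w t J) <= K ^+ 2.
Proof.
move=> mw TK.
have [_] := synthesis_of_haar_mult_bound mw TK (fun=> 1) (s := [:: J]) isT.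
rewrite (_ : synthesis _ _ _ = haar_atom w t J).
  by rewrite big_seq1 expr1n mulr1.
by apply/funext => x; rewrite /synthesis big_seq1 mul1r.
Qed.

Lemma bessel_of_haar_mult_bound w t K : 0 < K -> measurable_fun setT w ->
  haar_mult_bound w t K -> bessel mu (haar_atom w t) (K ^+ 2).
Proof.
move=> K0 mw TK; apply: bessel_of_synthesis.
- exact: exprn_gt0.
- by move=> J; exact: haar_atom_L2 TK.
by move=> b s us; have [] := synthesis_of_haar_mult_bound mw TK b us.
Qed.

End haar_system.

(** * Averages over dyadic intervals *)

Section averages.
Context {R : realType}.
Local Notation mu := (@lebesgue_measure R).
Implicit Types (u v w : R -> R) (I J : dyadic) (x : R).

Definition locally_L1 u := forall J, mu.-integrable (ditv J) (EFin \o u).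

Lemma measurable_powRl u (s : R) : measurable_fun setT u ->
  measurable_fun setT (fun x => u x `^ s).
Proof. by move=> mu_; exact: (measurableT_comp (measurable_powR s)). Qed.

Lemma locally_L1_of_locally_integrable u :
  locally_integrable [set: R] u -> locally_L1 u.
Proof.
move=> [mu_ _ ui] J.
pose a := dlen J * J.2%:~R : R; pose b := dlen J * (J.2 + 1)%:~R : R.
have h : mu.-integrable `[a, b] (EFin \o u).
  apply/integrableP; split.
    by apply/measurable_EFinP; exact: measurable_funTS.
  by apply: ui => //; exact: segment_compact.
apply: integrableS h => //; first exact: measurable_ditv.
move=> x; rewrite /ditv/= !in_itv/= => /andP[-> /ltW]; exact.
Qed.

Lemma locally_L1_le u v : measurable_fun setT u -> (forall x, 0 <= u x <= v x) ->
  locally_L1 v -> locally_L1 u.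
Proof.
move=> mu_ uv vL J; apply: le_integrable (vL J).
- exact: measurable_ditv.
- by apply/measurable_EFinP; exact: measurable_funTS.
move=> x _ /=; rewrite lee_fin; have /andP[u0 uvx] := uv x.
by rewrite !ger0_norm// (le_trans u0).
Qed.

Lemma patch_dind u J : (u \_ (ditv J)) = (fun x => u x * dind J x).
Proof.
apply/funext => x; rewrite patchE.
case: ifPn => [/set_mem h|/negP h]; first by rewrite dind_eq1// mulr1.
by rewrite dind_eq0 ?mulr0// => ?; apply: h; exact/mem_set.
Qed.

Lemma locally_L1P u : locally_L1 u <->
  forall J, mu.-integrable setT (EFin \o (fun x => u x * dind J x)).
Proof.
split=> h J.
  have := (integrable_mkcond (mu := mu) (EFin \o u) (measurable_ditv J)).1 (h J).
  by rewrite restrict_EFin patch_dind.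
apply: (integrable_mkcond (mu := mu) (EFin \o u) (measurable_ditv J)).2.
by rewrite restrict_EFin patch_dind.
Qed.

Lemma locally_L1_cst (c : R) : locally_L1 (cst c).
Proof.
apply/locally_L1P => J; have := L2_prod_integrable (L2Z c (dind_L2 J)) (dind_L2 J).
by congr (integrable _ _ _); apply/funext => x /=; rewrite -mulrA -expr2 dind_sqr.
Qed.

Lemma locally_L1_affine (a b : R) u : locally_L1 u ->
  locally_L1 (fun x => a + b * u x).
Proof.
move=> uL J; have h := integrableD (mu := mu) (measurable_ditv J) (locally_L1_cst a J)
  (integrableZl (mu := mu) (measurable_ditv J) b (uL J)).
by apply: eq_integrable h => //; exact: measurable_ditv.
Qed.

Lemma avg_le u v J : locally_L1 u -> locally_L1 v -> (forall x, u x <= v x) ->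
  avg u J <= avg v J.
Proof.
move=> uL vL uv; rewrite /avg ler_pM2l ?invr_gt0 ?dlen_gt0//.
by apply: le_Rintegral => //; exact: measurable_ditv.
Qed.

Lemma avgeE u J : locally_L1 u -> avge u J = (avg u J)%:E.
Proof.
move=> uL; rewrite /avge /avg EFinM; congr (_ * _)%E.
rewrite /Rintegral fineK//; apply: integrable_fin_num => //.
exact: measurable_ditv.
Qed.

Lemma locally_L1_of_avge u : measurable_fun setT u -> (forall x, 0 <= u x) ->
  (forall J, (avge u J < +oo)%E) -> locally_L1 u.
Proof.
move=> mu_ u0 ufin J; apply/integrableP; split.
  by apply/measurable_EFinP; exact: measurable_funTS.
under eq_integral do rewrite /= ger0_norm//.
have : (0 <= \int[mu]_(x in ditv J) (u x)%:E)%E.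
  by apply: integral_ge0 => x _; rewrite lee_fin.
have := ufin J; rewrite /avge; case: (integral _ _ _) => [r _ _|+ _|//].
  exact: ltry.
by rewrite gt0_muley ?ltxx// lte_fin invr_gt0 dlen_gt0.
Qed.

Lemma avg_dind u J : avg u J = (dlen J)^-1 * \int[mu]_x (u x * dind J x).
Proof. by rewrite /avg Rintegral_mkcond patch_dind. Qed.

Lemma avg_affine (a b : R) u J : locally_L1 u ->
  avg (fun x => a + b * u x) J = a + b * avg u J.
Proof.
move=> /locally_L1P uL; rewrite !avg_dind.
have -> : \int[mu]_x ((a + b * u x) * dind J x) =
    \int[mu]_x (a * dind J x) + \int[mu]_x (b * (u x * dind J x)).
  rewrite -RintegralD//.
  - by apply: eq_Rintegral => x _; ring.
  - exact: (locally_L1P _).1 (locally_L1_cst a) J.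
  - exact: (integrableZl (mu := mu) measurableT b (uL J)).
rewrite !RintegralZl//; last exact: dind_integrable.
rewrite Rintegral_dind.
by field; rewrite gt_eqF// dlen_gt0.
Qed.

Lemma avg_halves u I : locally_L1 u ->
  avg u I = (avg u (dleft I) + avg u (dright I)) / 2.
Proof.
move=> /locally_L1P uL; rewrite !avg_dind dlen_dleft dlen_dright.
have -> : \int[mu]_x (u x * dind I x) =
    \int[mu]_x (u x * dind (dleft I) x) + \int[mu]_x (u x * dind (dright I) x).
  rewrite -RintegralD//.
  by apply: eq_Rintegral => x _; rewrite (dind_halves I) mulrDr.
by field; rewrite gt_eqF// dlen_gt0.
Qed.

Lemma avg_gt0 u J : locally_L1 u -> (forall x, 0 < u x) -> 0 < avg u J.
Proof.
move=> uL u0; rewrite mulr_gt0 ?invr_gt0 ?dlen_gt0//.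
have mJ := @measurable_ditv R J.
rewrite lt_neqAle Rintegral_ge0 ?andbT; last by move=> x _; exact: ltW.
apply/negP => /eqP/esym i0.
have : (\int[mu]_(x in ditv J) `|(EFin \o u) x| = 0)%E.
  under eq_integral do rewrite /= ger0_norm ?(ltW (u0 _))//.
  rewrite -[RHS]/(0%:E) -i0 fineK//; exact: integrable_fin_num (uL J).
have mu_ : measurable_fun (ditv J) (EFin \o u) by have /integrableP[] := uL J.
move=> /(ae_eq_integral_abs mu mJ mu_) h.
have /(negligibleP mu mJ) : mu.-negligible (ditv J).
  apply: negligibleS h => x Jx /=; apply/not_implyP; split => //= /eqP.
  by rewrite eqe gt_eqF.
move=> J0; have : (dlen J)%:E = 0%E :> \bar R by rewrite -mu_ditv; exact: J0.
by move/eqP; rewrite eqe gt_eqF// dlen_gt0.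
Qed.

Lemma local_ip_avg v J : local_ip v v J = dlen J * avg (fun x => v x ^+ 2) J.
Proof.
rewrite avg_dind mulrA mulfV ?gt_eqF ?dlen_gt0// mul1r.
by apply: eq_Rintegral => x _; rewrite expr2.
Qed.

Lemma locally_L2P v : measurable_fun setT v ->
  locally_L2 v <-> locally_L1 (fun x => v x ^+ 2).
Proof.
move=> mv; split=> [vL|/locally_L1P vL J].
  apply/locally_L1P => J; have := local_ip_integrable J vL vL.
  by congr (integrable _ _ _); apply/funext => x /=; rewrite expr2.
apply/L2P; split; first by apply: measurable_funM => //; exact: measurable_dind.
have /integrableP[_] := vL J; congr (_ < _)%E.
apply: eq_integral => x _ /=.
by rewrite exprMn dind_sqr ger0_norm// mulr_ge0 ?sqr_ge0 ?dind_ge0.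
Qed.

End averages.

(** * The multiplier of a positive weight *)

Section positive_weights.
Context {R : realType}.
Local Notation mu := (@lebesgue_measure R).
Implicit Types (I J : dyadic) (x s t K M : R).
Variable w : R -> R.
Hypotheses (w0 : forall x, 0 < w x) (wm : measurable_fun setT w) (wL : locally_L1 w).

Let avg0 J : 0 < avg w J.
Proof. exact: avg_gt0. Qed.

Local Notation pw s := (fun x => w x `^ s).

(** The tangent to x^s at the average m of w, composed with w: its average is m^s,
so that the Bernoulli inequalities integrate to Jensen's inequality. *)
Lemma avg_tangent s J : avg (fun x => avg w J `^ s * (1 - s) +
  avg w J `^ s * s / avg w J * w x) J = avg w J `^ s.
Proof. by rewrite avg_affine//; field; rewrite gt_eqF. Qed.

Lemma pw_tangent_eq s J x : avg w J `^ s * (1 - s) + avg w J `^ s * s / avg w J * w x =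
  avg w J `^ s * (1 + s * (w x / avg w J - 1)).
Proof. by field; rewrite gt_eqF. Qed.

Lemma pw_normalize s J x : w x `^ s = avg w J `^ s * (w x / avg w J) `^ s.
Proof.
rewrite -(powRM _ (ltW (avg0 J)) (divr_ge0 (ltW (w0 x)) (ltW (avg0 J)))).
by rewrite mulrC divfK// gt_eqF.
Qed.

Lemma locally_L1_pw_le1 s : 0 <= s <= 1 -> locally_L1 (pw s).
Proof.
move=> s01; apply: (locally_L1_le (v := fun x => 1 + 1 * w x)).
- exact: measurable_powRl.
- move=> x; rewrite powR_ge0/=; apply: le_trans (bernoulli_le s01 (w0 x)) _.
  by have := w0 x; nra.
exact: locally_L1_affine.
Qed.

Lemma avg_pw_le1 s J : 0 <= s <= 1 -> avg (pw s) J <= avg w J `^ s.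
Proof.
move=> s01; rewrite -[leRHS]avg_tangent; apply: avg_le.
- exact: locally_L1_pw_le1.
- exact: locally_L1_affine.
move=> x; rewrite pw_tangent_eq (pw_normalize s J) ler_pM2l ?powR_gt0//.
by apply: bernoulli_le => //; exact: divr_gt0.
Qed.

Lemma avg_pw_ge s J : 1 <= s \/ s <= 0 -> locally_L1 (pw s) ->
  avg w J `^ s <= avg (pw s) J.
Proof.
move=> hs sL; rewrite -[leLHS]avg_tangent; apply: avg_le => //.
  exact: locally_L1_affine.
move=> x; rewrite pw_tangent_eq (pw_normalize s J) ler_pM2l ?powR_gt0//.
by apply: bernoulli_ge => //; exact: divr_gt0.
Qed.

Variable t : R.
Local Notation v := (pw t).
Local Notation sg := (pw (2 * t)).

Let kap J : R := avg w J `^ (- t).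

Let sqr_pwE x : w x `^ t ^+ 2 = w x `^ (2 * t).
Proof. by rewrite -powR_mulrn ?powR_ge0// -powRrM mulrC. Qed.

Lemma sqr_pw : (fun x => w x `^ t ^+ 2) = sg.
Proof. by apply/funext => x; exact: sqr_pwE. Qed.

Lemma sqr_kap J : kap J ^+ 2 = (avg w J `^ (2 * t))^-1.
Proof.
by rewrite /kap -powR_mulrn ?powR_ge0// -powRrM -powRN; congr powR; ring.
Qed.

Lemma haar_atomE : haar_atom w t = fun J x => kap J * (v x * haar J x).
Proof.
apply/funext => J; apply/funext => x; rewrite /haar_atom mulrA; congr (_ * _).
by rewrite (pw_normalize t J) mulrA /kap powRN mulVf ?mul1r// gt_eqF// powR_gt0.
Qed.

Lemma local_ip_sg J : local_ip v v J = dlen J * avg sg J.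
Proof. by rewrite local_ip_avg sqr_pw. Qed.

Lemma locally_L2_v : locally_L1 sg -> locally_L2 v.
Proof.
by move=> sL; apply/locally_L2P; [exact: measurable_powRl|rewrite sqr_pw].
Qed.

Lemma local_ip_jump J : kap J ^+ 2 / dlen J *
    (local_ip v v (dright J) - local_ip v v (dleft J)) ^+ 2 =
  4^-1 * (dlen J * (avg_jump sg J ^+ 2 / avg w J `^ (2 * t))).
Proof.
rewrite !local_ip_sg sqr_kap dlen_dleft dlen_dright /avg_jump.
by field; rewrite !gt_eqF ?dlen_gt0 ?powR_gt0.
Qed.

Definition jump_energy J : R := dlen J * (avg_jump sg J ^+ 2 / avg w J `^ (2 * t)).

(** [C] bounds the norms of the atoms, and [C3] is the packing constant of the
jumps; the factor 1/4 in [local_ip_jump] turns the latter into C3 / 4. *)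
Theorem haar_mult_bound_of_carleson (C C3 : R) : locally_L1 sg ->
  0 <= C -> 0 < C3 -> (forall J, avg sg J <= C * avg w J `^ (2 * t)) ->
  (forall n I, tree_sum jump_energy n I <= C3 * (dlen I * avg sg I)) ->
  haar_mult_bound w t (Num.sqrt (2 * C + 2 * C3)).
Proof.
move=> sL C0 C30 sC sC3; apply: haar_mult_bound_of_bessel.
- by lra.
- by move=> J; rewrite haar_atomE; apply: L2Z; apply: mul_haar_L2; exact: locally_L2_v.
rewrite haar_atomE (_ : 2 * C + 2 * C3 = 2 * C + 8 * (C3 / 4)); last by field.
apply: modulated_haar_bessel => //.
- exact: locally_L2_v.
- move=> J; rewrite local_ip_sg mulr_gt0 ?dlen_gt0//; apply: avg_gt0 => // x.
  exact: powR_gt0.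
- by lra.
- move=> J; rewrite local_ip_sg sqr_kap.
  have m0 : 0 < avg w J `^ (2 * t) by exact: powR_gt0.
  rewrite -(ler_pM2r m0); apply: le_trans (sC J).
  by rewrite le_eqVlt; apply/orP; left; apply/eqP; field; rewrite !gt_eqF ?dlen_gt0.
move=> n I; rewrite /tree_sum; under eq_bigr do rewrite local_ip_jump.
rewrite -mulr_sumr local_ip_sg.
have := sC3 n I; rewrite /tree_sum; under eq_bigr do rewrite /jump_energy.
lra.
Qed.

(** h_J^2 being 1 / |J| on J, the square of an atom is sigma on J up to a
constant. *)
Lemma avg_of_haar_mult_bound K : haar_mult_bound w t K ->
  locally_L1 sg /\ forall J, avg sg J <= K ^+ 2 * avg w J `^ (2 * t).
Proof.
move=> TK.
have aL J : haar_atom w t J \in Lfun mu 2%:E by exact: haar_atom_L2 TK.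
have k0 J : 0 < kap J by exact: powR_gt0.
have vE J x : sg x * dind J x = dlen J / kap J ^+ 2 * haar_atom w t J x ^+ 2.
  rewrite haar_atomE -sqr_pwE haarE !exprMn sqr_sqrt_dlen.
  have -> : (dind (dright J) x - dind (dleft J) x) ^+ 2 = dind J x.
    have := @dind_dleft_dright R J x; have := @dind_sqr R (dleft J) x.
    have := @dind_sqr R (dright J) x; rewrite (dind_halves J).
    set a := dind (dleft J) x; set b := dind (dright J) x => b2 a2 ab.
    have -> : (b - a) ^+ 2 = b ^+ 2 + a ^+ 2 - 2 * (a * b) by ring.
    by rewrite a2 b2 ab mulr0 subr0 addrC.
  by field; rewrite !gt_eqF ?dlen_gt0.
have sL : locally_L1 sg.
  apply/locally_L1P => J.
  have := L2_prod_integrable (L2Z (dlen J / kap J ^+ 2) (aL J)) (aL J).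
  congr (integrable _ _ _); apply/funext => x /=.
  by rewrite vE; congr EFin; ring.
split => // J; rewrite avg_dind; under eq_Rintegral do rewrite vE expr2.
rewrite RintegralZl//; last exact: L2_prod_integrable.
have := ip_haar_atom_le J wm TK; rewrite /ip => h.
set i := Rintegral _ _ _ in h *.
have -> : (dlen J)^-1 * (dlen J / kap J ^+ 2 * i) = i * avg w J `^ (2 * t).
  by rewrite sqr_kap; field; rewrite !gt_eqF ?dlen_gt0 ?powR_gt0.
by rewrite ler_pM2r// powR_gt0.
Qed.

(** Bessel inequality for v on I, 0 outside: the coefficient on the atom at J is the
jump of sigma between the halves of J, whatever the place of J in I. *)
Lemma jump_energy_of_haar_mult_bound K I (s : seq dyadic) : 0 < K ->
  haar_mult_bound w t K -> uniq s ->
  (forall J, J \in s -> ditv J `<=` (ditv I : set R)) ->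
  \sum_(J <- s) jump_energy J <= 4 * K ^+ 2 * (dlen I * avg sg I).
Proof.
move=> K0 TK us sI.
have [sL _] := avg_of_haar_mult_bound TK.
have vL := locally_L2_v sL.
have := bessel_of_haar_mult_bound K0 wm TK us (vL I).
set G := fun x => v x * dind I x.
have -> : ip mu G G = dlen I * avg sg I by rewrite -local_ipE local_ip_sg.
have -> : \sum_(J <- s) ip mu G (haar_atom w t J) ^+ 2 =
    \sum_(J <- s) 4^-1 * jump_energy J.
  apply: eq_big_seq => J /sI/subset_ditvP JI.
  rewrite haar_atomE ipC ipZl; [|exact: mul_haar_L2|exact: vL].
  rewrite ipC ip_mul_haar; [|exact: vL|exact: vL].
  have half P : P = dleft J \/ P = dright J -> local_ip G v P = local_ip v v P.
    move=> PJ; apply: eq_Rintegral => x _.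
    have e : dind P x * dind I x = dind P x.
      by rewrite -(dind_half x PJ) -mulrA JI.
    by rewrite -[in RHS]e /G; ring.
  rewrite !half; [|by left|by right].
  by rewrite /jump_energy -local_ip_jump !exprMn sqr_sqrt_dlen mulrA.
rewrite -mulr_sumr; lra.
Qed.

Lemma carlesonP (C3 : R) : locally_L1 sg ->
  carleson w t C3 <->
  forall I (l : seq dyadic), uniq l ->
    (forall J, J \in l -> ditv J `<=` (ditv I : set R)) ->
    \sum_(J <- l) jump_energy J <= C3 * (dlen I * avg sg I).
Proof.
move=> sL; split=> [H I l ul lI|H I].
  have := H I; rewrite avgeE// -EFinM.
  set S := esum _ _ => hS.
  have : ((\sum_(J <- l) jump_energy J)%:E <= S)%E.
    apply: esum_ge; exists [set` l].
      by split; [exact: finite_seq|move=> J /=; exact: lI].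
    rewrite -fsbig_seq// -sumEFin.
    apply: lee_sum => J _; rewrite lee_fin /jump_energy.
    by rewrite real_normK// num_real.
  move: hS; case: S => [r| |]//.
  - rewrite -EFinM !lee_fin => h1 h2; apply: le_trans h2 _.
    have := h1; rewrite ler_pdivrMl ?dlen_gt0// => /le_trans; apply.
    by rewrite le_eqVlt; apply/orP; left; apply/eqP; ring.
  by rewrite gt0_muley ?lte_fin ?invr_gt0 ?dlen_gt0// leye_eq.
rewrite avgeE// -EFinM.
have -> : (C3 * avg sg I)%:E = ((dlen I)^-1%:E * (C3 * (dlen I * avg sg I))%:E)%E.
  by rewrite -EFinM; congr EFin; field; rewrite gt_eqF// dlen_gt0.
apply: lee_wpmul2l; first by rewrite lee_fin invr_ge0 ltW// dlen_gt0.
apply: ub_ereal_sup => _ [A [finA AI] <-].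
rewrite fsbig_finite//= sumEFin lee_fin.
apply: le_trans (H I (fset_set A) (fset_uniq _) _).
  apply: ler_sum => J _; rewrite /jump_energy.
  by rewrite real_normK// num_real.
by move=> J; rewrite in_fset_set// => /set_mem /AI.
Qed.

End positive_weights.

(** * Almost everywhere equal weights *)

Section almost_everywhere.
Context {R : realType}.
Local Notation mu := (@lebesgue_measure R).
Implicit Types (u w f g : R -> R) (I J : dyadic).

Definition ae_equal u w := {ae mu, forall x, u x = w x}.

Lemma ae_mono (P Q : R -> Prop) : (forall x, P x -> Q x) ->
  {ae mu, forall x, P x} -> {ae mu, forall x, Q x}.
Proof. by move=> PQ; apply: negligibleS => x /= nQ /PQ. Qed.

Lemma avge_ae u w J : measurable_fun setT u -> measurable_fun setT w ->
  ae_equal u w -> avge u J = avge w J.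
Proof.
move=> mu_ mw uw; congr (_ * _)%E; apply: ae_eq_integral.
- exact: measurable_ditv.
- by apply/measurable_EFinP; exact: measurable_funTS.
- by apply/measurable_EFinP; exact: measurable_funTS.
by apply: ae_mono uw => x -> _.
Qed.

Lemma avg_ae u w J : measurable_fun setT u -> measurable_fun setT w ->
  ae_equal u w -> avg u J = avg w J.
Proof.
move=> mu_ mw uw; congr (_ * fine _); apply: ae_eq_integral.
- exact: measurable_ditv.
- by apply/measurable_EFinP; exact: measurable_funTS.
- by apply/measurable_EFinP; exact: measurable_funTS.
by apply: ae_mono uw => x -> _.
Qed.

Lemma powR_ae u w (s : R) : ae_equal u w ->
  ae_equal (fun x => u x `^ s) (fun x => w x `^ s).
Proof. by apply: ae_mono => x ->. Qed.

Lemma C_char_ae u w (s : R) : measurable_fun setT u -> measurable_fun setT w ->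
  ae_equal u w -> C_char u s = C_char w s.
Proof.
move=> mu_ mw uw; 
have e1 I : avge (fun x => u x `^ s) I = avge (fun x => w x `^ s) I.
  apply: avge_ae; [exact: measurable_powRl|exact: measurable_powRl|].
  exact: powR_ae.
have e2 I : avg u I = avg w I by exact: avg_ae.
pose F z I := (avge (fun x => z x `^ s)%R I * (avg z I `^ (- s))%:E)%E.
have e : F u = F w by apply/funext => I; rewrite /F e1 e2.
by rewrite -[LHS]/(ereal_sup [set F u I | I in [set: dyadic]]) e.
Qed.

Lemma carleson_ae u w (t : R) : measurable_fun setT u -> measurable_fun setT w ->
  ae_equal u w -> carleson u t = carleson w t.
Proof.
move=> mu_ mw uw; apply/funext => C3.
have mu2 := measurable_powRl (2 * t) mu_; have mw2 := measurable_powRl (2 * t) mw.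
have uw2 := powR_ae (2 * t) uw.
have e1 I : avge (fun x => u x `^ (2 * t)) I = avge (fun x => w x `^ (2 * t)) I.
  exact: avge_ae.
have e2 I : avg (fun x => u x `^ (2 * t)) I = avg (fun x => w x `^ (2 * t)) I.
  exact: avg_ae.
have e3 I : avg u I = avg w I by exact: avg_ae.
pose E z J := dlen J * (`|avg_jump (fun x => z x `^ (2 * t)) J| ^+ 2 /
  avg z J `^ (2 * t)).
have e : E u = E w by apply/funext => J; rewrite /E /avg_jump !e2 e3.
have H z : carleson z t C3 = forall I,
  ((dlen I)^-1%:E * (\esum_(J in [set J : dyadic | ditv J `<=` (ditv I : set R)])
    (E z J)%:E) <= C3%:E * avge (fun x => z x `^ (2 * t))%R I)%E by [].
by rewrite !H e; apply: eq_forall => I; rewrite e1.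
Qed.

Lemma haar_mult_bound_ae u w (t : R) : measurable_fun setT u ->
  measurable_fun setT w -> ae_equal u w ->
  haar_mult_bound u t = haar_mult_bound w t.
Proof.
suff W u' w' K : measurable_fun setT u' -> measurable_fun setT w' ->
    ae_equal u' w' -> haar_mult_bound u' t K -> haar_mult_bound w' t K.
  move=> mu_ mw uw; apply/funext => K; apply/propext; split; apply: W => //.
  by apply: ae_mono uw => x ->.
move=> mu_ mw uw [K0 B]; split; first exact: K0.
move=> f fL; have [g [gL gc] gK] := B f fL.
exists g; last exact: gK.
split; first exact: gL.
move=> eps /gc[F0 hF]; exists F0 => F /hF.
have mg := L2_measurable gL.
have mS z : measurable_fun setT z ->
    measurable_fun setT (fun x => g x - haar_mult_sum z t F f x).
  move=> mz; apply: measurable_funB => //.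
  rewrite (_ : haar_mult_sum z t F f = synthesis (haar_atom z t) (haar_coef f) F).
    by apply: measurable_sum => J; apply: measurable_funM => //; exact: measurable_haar_atom.
  by apply/funext => x; rewrite haar_mult_sumE.
move=> h.
suff e : norm2 (g \- haar_mult_sum w' t F f)%R = norm2 (g \- haar_mult_sum u' t F f)%R.
  by rewrite e; exact: h.
have sqrtE z : norm2 (g \- haar_mult_sum z t F f)%R =
    poweR (\int[mu]_x ((g x - haar_mult_sum z t F f x) ^+ 2)%:E)%E 2^-1.
  exact: norm2_sqrt_integral.
rewrite (sqrtE w') (sqrtE u'); apply: (congr1 (fun z => poweR z 2^-1)).
apply: ae_eq_integral.
- exact: measurableT.
- by apply/measurable_EFinP; apply: measurable_funX; exact: mS.
- by apply/measurable_EFinP; apply: measurable_funX; exact: mS.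
apply: (ae_mono _ uw) => x uwx _.
have e : haar_mult_sum w' t F f x = haar_mult_sum u' t F f x.
  by apply: eq_bigr => J _; rewrite uwx (avg_ae J mu_ mw uw).
by rewrite /= e.
Qed.

(** Positivity at every point makes real powers multiplicative, so that an atom is a
multiple of v h_J pointwise and not only almost everywhere. *)
Lemma positive_version w : weight w -> exists w' : R -> R,
  [/\ forall x, 0 < w' x, measurable_fun setT w', locally_L1 w',
      measurable_fun setT w & ae_equal w w'].
Proof.
move=> [wloc w0]; have [mw _ _] := wloc.
have wL := locally_L1_of_locally_integrable wloc.
pose w' x := if 0 < w x then w x else 1.
have mw' : measurable_fun setT w'.
  by apply: measurable_fun_ifT => //; exact: measurable_fun_ltr.
have ww' : ae_equal w w' by apply: ae_mono w0 => x; rewrite /w' => ->.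
exists w'; split => //.
  by move=> x; rewrite /w'; case: ifPn.
apply: locally_L1_of_avge => //.
  by move=> x; rewrite /w'; case: ifPn => // /ltW.
by move=> J; rewrite -(avge_ae J mw mw' ww') avgeE// ltry.
Qed.

End almost_everywhere.

(** * The operator norm *)

Section operator_norm.
Context {R : realType}.
Variables (w : R -> R) (t : R).
Implicit Types (K c : R).

Lemma haar_mult_boundW K K' : K <= K' -> haar_mult_bound w t K ->
  haar_mult_bound w t K'.
Proof.
move=> KK' [K0 B]; split; first exact: le_trans KK'.
move=> f fL; have [g gc gK] := B f fL; exists g => //; apply: le_trans gK _.
by apply: lee_wpmul2r; [exact: Lnorm_ge0|rewrite lee_fin].
Qed.

Lemma haar_mult_norm_ge0 : (0 <= haar_mult_norm w t)%E.
Proof. by apply: le_ereal_inf_tmp => _ [K [K0 _] <-]; rewrite lee_fin. Qed.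

Lemma haar_mult_norm_sqr_le K : haar_mult_bound w t K ->
  (haar_mult_norm w t ^+ 2 <= (K ^+ 2)%:E)%E.
Proof.
move=> TK; have h : (haar_mult_norm w t <= K%:E)%E.
  by apply: ereal_inf_lbound; exists K.
rewrite !expe2 EFinM; apply: lee_pmul => //; exact: haar_mult_norm_ge0.
Qed.

(** The square of the infimum of the bounds K is the infimum of their squares; any
bound can be increased, hence only positive ones matter. *)
Lemma le_haar_mult_norm_sqr (X : \bar R) c : 0 < c ->
  (forall K, 0 < K -> haar_mult_bound w t K -> (X <= (c * K ^+ 2)%:E)%E) ->
  (X <= c%:E * haar_mult_norm w t ^+ 2)%E.
Proof.
move=> c0 H; have := haar_mult_norm_ge0.
case: (eqVneq (haar_mult_norm w t) +oo%E) => [-> _|Noo N0].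
  by rewrite expe2 mulyy gt0_muley ?lte_fin// leey.
have Nfin : haar_mult_norm w t \is a fin_num by rewrite ge0_fin_numE// ltey.
pose n := fine (haar_mult_norm w t).
have NE : haar_mult_norm w t = n%:E by rewrite fineK.
have n0 : 0 <= n by rewrite -lee_fin -NE.
have bound e : 0 < e -> haar_mult_bound w t (n + e).
  move=> e0; have : (haar_mult_norm w t < (n + e)%:E)%E by rewrite NE lte_fin ltrDl.
  move=> /ereal_inf_lt[_ [K TK <-]]; rewrite lte_fin => /ltW KN.
  exact: haar_mult_boundW TK.
rewrite NE expe2 -!EFinM; apply/lee_addgt0Pr => d d0.
pose e := Num.min 1 (d / (c * (2 * n + 1))).
have q0 : 0 < c * (2 * n + 1) by rewrite mulr_gt0//; lra.
have e0 : 0 < e by rewrite /e lt_min ltr01 divr_gt0.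
have e1 : e <= 1 by rewrite /e ge_min lexx.
have ed : e * (c * (2 * n + 1)) <= d.
  by rewrite -ler_pdivlMr// /e ge_min lexx orbT.
apply: le_trans (H _ _ (bound e e0)) _; first lra.
rewrite -EFinD lee_fin.
have : c * e ^+ 2 <= c * e.
  by rewrite ler_pM2l// expr2 ler_piMr// ltW.
lra.
Qed.

End operator_norm.

Section C_char_bounds.
Context {R : realType}.
Variables (w : R -> R) (t : R).
Hypotheses (w0 : forall x, 0 < w x) (wm : measurable_fun setT w) (wL : locally_L1 w).
Local Notation sg := (fun x => w x `^ (2 * t)).

Let avg0 J : 0 < avg w J.
Proof. exact: avg_gt0. Qed.

Lemma C_char_leP (M : R) : (C_char w (2 * t) <= M%:E)%E <->
  locally_L1 sg /\ forall J, avg sg J <= M * avg w J `^ (2 * t).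
Proof.
have m0 J : 0 < avg w J `^ (2 * t) by exact: powR_gt0.
split=> [h|[sL h]].
  have hJ J : (avge sg J * (avg w J `^ (- (2 * t)))%:E <= M%:E)%E.
    by apply: le_trans h; apply: ereal_sup_ubound; exists J.
  have sL : locally_L1 sg.
    apply: locally_L1_of_avge; first exact: measurable_powRl.
      by move=> x; exact: powR_ge0.
    move=> J; rewrite ltey; apply/negP => /eqP E; have := hJ J.
    by rewrite E gt0_mulye ?lte_fin ?powR_gt0// leye_eq.
  split => // J; have := hJ J; rewrite avgeE// -EFinM lee_fin powRN.
  by rewrite ler_pdivrMr.
apply: ge_ereal_sup => _ [J _ <-].
by rewrite avgeE// -EFinM lee_fin powRN ler_pdivrMr.
Qed.

(** Jensen's inequality on any dyadic interval. *)
Lemma C_char_ge1 : 1 <= 2 * t \/ 2 * t <= 0 -> (1 <= C_char w (2 * t))%E.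
Proof.
move=> ht.
have key M : (C_char w (2 * t) <= M%:E)%E -> 1 <= M.
  move=> /C_char_leP[sL h].
  have := le_trans (avg_pw_ge w0 wL (0, 0) ht sL) (h (0, 0)).
  by rewrite -[leLHS]mul1r ler_pM2r ?powR_gt0.
case E : (C_char w (2 * t)) key => [M| |] key; last 2 first.
- by rewrite leey.
- by have := key 0 (leNye _); rewrite ler10.
by rewrite lee_fin key.
Qed.

End C_char_bounds.

(** * The two ranges of exponents *)

Section positive_weight_theorem.
Context {R : realType}.
Variables (w : R -> R) (t : R).
Hypotheses (w0 : forall x, 0 < w x) (wm : measurable_fun setT w) (wL : locally_L1 w).
Local Notation sg := (fun x => w x `^ (2 * t)).

Lemma C_char_le_norm : (C_char w (2 * t) <= 1%:E * haar_mult_norm w t ^+ 2)%E.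
Proof.
apply: le_haar_mult_norm_sqr => // K _ TK; rewrite mul1r.
apply/C_char_leP => //; exact: avg_of_haar_mult_bound TK.
Qed.

Lemma C_char_lty_of_bounded : haar_mult_bounded w t -> (C_char w (2 * t) < +oo)%E.
Proof.
move=> [K TK]; apply: le_lt_trans (ltry (K ^+ 2)).
apply/C_char_leP => //; exact: avg_of_haar_mult_bound TK.
Qed.

(** Outside 0 < 2 t <= 1 the packing of the jumps of w^(2 t) is a consequence of
the C_2t condition, by the Bellman function. *)
Lemma bound_of_C_char (C M : R) : 1 < 2 * t \/ 2 * t <= 0 ->
  0 <= C -> convexity_gap (2 * t) C -> (C_char w (2 * t) <= M%:E)%E ->
  haar_mult_bound w t (Num.sqrt (2 * M + 2 * (8 * (1 + C) * M ^+ 3))).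
Proof.
move=> ht C0 gapC hM.
have ht1 : 1 <= 2 * t \/ 2 * t <= 0 by case: ht => h; [left; lra|right].
have M1 : 1 <= M by rewrite -lee_fin; apply: le_trans hM; exact: C_char_ge1.
have M0 : 0 <= M by lra.
have [sL sM] : locally_L1 sg /\ forall J, avg sg J <= M * avg w J `^ (2 * t).
  by apply/C_char_leP.
apply: haar_mult_bound_of_carleson => //.
  by rewrite mulr_gt0 ?exprn_gt0//; lra.
move=> n I; apply: bellman_tree => //.
- by move=> J; exact: avg_gt0.
- by move=> J; apply: avg_gt0 => // x; exact: powR_gt0.
- by move=> J; exact: avg_halves.
- by move=> J; exact: avg_halves.
by move=> J; exact: avg_pw_ge.
Qed.

Lemma carleson_of_bound K : 0 < K -> haar_mult_bound w t K ->
  carleson w t (4 * K ^+ 2).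
Proof.
move=> K0 TK; have [sL _] := avg_of_haar_mult_bound w0 wm wL TK.
apply/carlesonP => // I l ul lI; exact: jump_energy_of_haar_mult_bound.
Qed.

Lemma bound_of_carleson (C3 : R) : 0 <= 2 * t <= 1 -> 0 < C3 ->
  carleson w t C3 -> haar_mult_bound w t (Num.sqrt (2 + 2 * C3)).
Proof.
move=> ht C30 hC; have sL : locally_L1 sg by exact: locally_L1_pw_le1.
rewrite -[X in X + _]mulr1; apply: haar_mult_bound_of_carleson => //.
  by move=> J; rewrite mul1r; exact: avg_pw_le1.
move=> n I; have [H _] := carlesonP C3 sL.
apply: (H hC) => //; first exact: (@uniq_descendants R).
by move=> J Jd; apply/subset_ditvP => x; exact: dind_descendants Jd.
Qed.

Lemma carleson_const_le_norm :
  (carleson_const w t <= 4%:E * haar_mult_norm w t ^+ 2)%E.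
Proof.
apply: le_haar_mult_norm_sqr => // K K0 TK; apply: ereal_inf_lbound.
exists (4 * K ^+ 2) => //; split; first by rewrite mulr_gt0 ?exprn_gt0.
exact: carleson_of_bound.
Qed.

Lemma norm_le_carleson_const : 0 <= 2 * t <= 1 ->
  (haar_mult_norm w t ^+ 2 <= 4%:E * maxe 1 (carleson_const w t))%E.
Proof.
move=> ht.
have c0 : (0 <= carleson_const w t)%E.
  by apply: le_ereal_inf_tmp => _ [C3 [C30 _] <-]; rewrite lee_fin ltW.
case E : (carleson_const w t) c0 => [c| |]// c0; last first.
  by rewrite /maxe ltry gt0_muley ?lte_fin// leey.
have : (haar_mult_norm w t ^+ 2 <= (2 + 2 * c)%:E)%E.
  apply/lee_addgt0Pr => e e0.
  have : (carleson_const w t < (c + e / 2)%:E)%E by rewrite E lte_fin ltrDl divr_gt0.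
  move=> /ereal_inf_lt[_ [C3 [C30 hC] <-]]; rewrite lte_fin => C3c.
  have := haar_mult_norm_sqr_le (bound_of_carleson ht C30 hC).
  rewrite sqr_sqrtr; last by lra.
  by move=> /le_trans; apply; rewrite -EFinD lee_fin; lra.
move=> /le_trans; apply; rewrite /maxe; case: ifPn.
  by rewrite lte_fin -EFinM lee_fin => c1; lra.
by rewrite -leNgt lee_fin -EFinM lee_fin; lra.
Qed.

End positive_weight_theorem.

Theorem theorem4 (R : realType) (t : R) :
  (1 / 2 < t \/ t <= 0 ->
     exists (c : R) (K : R -> R), 0 < c /\ (forall M : R, 0 < K M) /\
       forall w : R -> R, weight w ->
         (haar_mult_bounded w t <-> (C_char w (2 * t) < +oo)%E) /\
         (C_char w (2 * t) <= c%:E * haar_mult_norm w t ^+ 2)%E /\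
         (forall M : R, (C_char w (2 * t) <= M%:E)%E ->
            (haar_mult_norm w t ^+ 2 <= (K M)%:E * C_char w (2 * t))%E)) /\
  (0 < t <= 1 / 2 ->
     exists C : R, 0 < C /\
       forall w : R -> R, weight w ->
         ((exists C3 : R, 0 < C3 /\ carleson w t C3) <->
            haar_mult_bounded w t) /\
         (carleson_const w t <= C%:E * haar_mult_norm w t ^+ 2)%E /\
         (haar_mult_norm w t ^+ 2 <= C%:E * maxe 1 (carleson_const w t))%E).
Proof.
split=> ht.
  have ht2 : 1 < 2 * t \/ 2 * t <= 0 by case: ht => h; [left|right]; lra.
  have ht1 : 1 <= 2 * t \/ 2 * t <= 0 by case: ht2 => h; [left; lra|right].
  have [C C0 gapC] := convexity_gap_exists ht2.
  pose k M := 2 * M + 2 * (8 * (1 + C) * M ^+ 3).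
  have k0 M : 0 <= M -> 0 <= k M.
    move=> M0; apply: addr_ge0; first lra.
    apply: mulr_ge0 => //; apply: mulr_ge0; first lra.
    exact: exprn_ge0.
  exists 1, (fun M => 1 + k `|M|); split => //; split.
    by move=> M; rewrite ltr_pwDl// k0.
  move=> w /positive_version[w' [w'0 w'm w'L wm ww']].
  rewrite /haar_mult_norm /haar_mult_bounded (C_char_ae _ wm w'm ww').
  rewrite (haar_mult_bound_ae t wm w'm ww').
  split; last split.
  - split; first exact: C_char_lty_of_bounded.
    have := C_char_ge1 w'0 w'm w'L ht1.
    case E : (C_char w' (2 * t)) => [M| |]// _ _.
    exists (Num.sqrt (k M)); apply: bound_of_C_char => //.
    by rewrite E.
  - exact: C_char_le_norm.
  move=> M hM; have X1 := C_char_ge1 w'0 w'm w'L ht1.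
  have M1 : 1 <= M by rewrite -lee_fin; exact: le_trans hM.
  have TK := bound_of_C_char w'0 w'm w'L ht2 C0 gapC hM.
  apply: le_trans (haar_mult_norm_sqr_le TK) _.
  have M0 : 0 <= M by lra.
  rewrite sqr_sqrtr ?k0// ger0_norm// -[leLHS]mule1.
  by apply: lee_pmul => //; rewrite lee_fin ?lerDr// k0.
have ht2 : 0 <= 2 * t <= 1 by lra.
exists 4; split => // w /positive_version[w' [w'0 w'm w'L wm ww']].
rewrite /carleson_const /haar_mult_norm /haar_mult_bounded.
rewrite (carleson_ae _ wm w'm ww') (haar_mult_bound_ae t wm w'm ww').
split; last split.
- split=> [[C3 [C30 hC]]|[K TK]].
    by exists (Num.sqrt (2 + 2 * C3)); exact: bound_of_carleson.
  have K1 : 0 < `|K| + 1 by rewrite ltr_wpDl.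
  have TK1 : haar_mult_bound w' t (`|K| + 1).
    by apply: haar_mult_boundW TK; rewrite (le_trans (ler_norm K))// lerDl.
  exists (4 * (`|K| + 1) ^+ 2); split; first by rewrite mulr_gt0 ?exprn_gt0.
  exact: carleson_of_bound.
- exact: carleson_const_le_norm.
exact: norm_le_carleson_const.
Qed.
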